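(* Let $(\mathcal{G},S_m)$ be a graph of groups on the star graph $S_m$ with a free group of finite rank associated to the central vertex, finitely generated right-angled Artin groups associated to the external vertices, and cyclic edge groups. For each edge $e_i$, $i=1,\dots,m$, let $k_i$ be a generator of the edge group $G_{e_i}$, and let $\alpha_{e_i}$ and $\omega_{e_i}$ be the monomorphisms of $G_{e_i}$ into the central vertex group and the corresponding external vertex group respectively. Assume that for all $i=1,\dots,m$ the element $\omega_{e_i}(k_i)$ is a generator of the external vertex group (or can be extended to a new RAAG generating set of it). Then the fundamental group $G=\pi_1(\mathcal{G},S_m)$ is $\mathbb{Z}$-linear.
   Context: The star graph $S_m$ is the tree with one central vertex joined by edges $e_1,\dots,e_m$ to $m$ external vertices (leaves); each $e_i$ is oriented from the central vertex to the leaf. If $F$ is the central vertex group and $K_1,\dots,K_m$ are the external vertex groups, $\pi_1(\mathcal{G},S_m)$ is the quotient of the free product $F*K_1*\cdots*K_m$ by the relations $\alpha_{e_i}(g)=\omega_{e_i}(g)$ for $g\in G_{e_i}$, $i=1,\dots,m$. A RAAG generating set of a right-angled Artin group $K$ is a generating set $S$ such that $K$ has a presentation $\langle S\mid R\rangle$ in which every relator in $R$ is a commutator of two elements of $S$; ''generator'' means an element of the standard RAAG generating set. A group is $\mathbb{Z}$-linear if it admits a faithful representation into $GL_n(\mathbb{Z})$ for some $n$. *)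

(* Defs.v *)
From HB Require Import structures.
From mathcomp Require Import all_boot all_order all_algebra.
From mathcomp Require Import boolp classical_sets cardinality.

Set Implicit Arguments.
Unset Strict Implicit.
Unset Printing Implicit Defensive.

Local Open Scope classical_set_scope.
Local Open Scope group_scope.
Local Open Scope quotient_scope.

Notation "{ 'hom' G -> H }" := (UMagmaMorphism.type G H)
  (at level 0, G at level 98, H at level 99, format "{ 'hom'  G  ->  H }")
  : type_scope.

Section Subgroups.
Variable G : groupType.

Definition is_subgroup (H : set G) : Prop :=
  [/\ H 1, forall x y, H x -> H y -> H (x * y) & forall x, H x -> H x^-1].

Definition is_normal_subgroup (N : set G) : Prop :=
  is_subgroup N /\ forall x y, N x -> N (x ^ y).

Definition subgroup_generated (S : set G) : set G := smallest is_subgroup S.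

Definition normal_closure (R : set G) : set G := smallest is_normal_subgroup R.

Definition generates (S : set G) : Prop := subgroup_generated S = setT.

Definition finitely_generated : Prop :=
  exists2 S : set G, finite_set S & generates S.

Lemma normal_closureP (R : set G) : is_normal_subgroup (normal_closure R).
Proof.
split; first split.
- by move=> N [[[]]].
- by move=> x y Rx Ry N HN; have [[[_ HM _] _] _] := HN; exact: HM (Rx N HN) (Ry N HN).
- by move=> x Rx N HN; have [[[_ _ HV] _] _] := HN; exact: HV (Rx N HN).
- by move=> x y Rx N HN; have [[_ HJ] _] := HN; exact: HJ (Rx N HN).
Qed.

Lemma sub_normal_closure (R : set G) : R `<=` normal_closure R.
Proof. by move=> x Rx N [_]; exact. Qed.

End Subgroups.

Section QuotientGroup.
Variables (G : groupType) (R : set G).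

Definition quotient_rel : rel G := fun x y => `[< normal_closure R (x^-1 * y) >].

Lemma quotient_rel_refl : reflexive quotient_rel.
Proof. by move=> x; apply/asboolP; rewrite mulVg; case: (normal_closureP R) => [[]]. Qed.

Lemma quotient_rel_sym : symmetric quotient_rel.
Proof.
have [[_ _ NV] _] := normal_closureP R.
by move=> x y; apply/asboolP/asboolP => /NV; rewrite invgM invgK.
Qed.

Lemma quotient_rel_trans : transitive quotient_rel.
Proof.
have [[_ NM _] _] := normal_closureP R.
move=> y x z /asboolP xy /asboolP yz; apply/asboolP.
by have := NM _ _ xy yz; rewrite -mulgA (mulgA y) mulgV mul1g.
Qed.

Canonical quotient_equiv :=
  EquivRel quotient_rel quotient_rel_refl quotient_rel_sym quotient_rel_trans.

(* The quotient of G by the normal closure of R. *)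
Definition quotient_group := {eq_quot quotient_rel}.
HB.instance Definition _ := Choice.on quotient_group.
HB.instance Definition _ := Quotient.on quotient_group.

Definition to_quotient (x : G) : quotient_group := \pi_quotient_group x.

Lemma to_quotientP x y :
  to_quotient x = to_quotient y <-> normal_closure R (x^-1 * y).
Proof.
by split=> [/eqmodP/asboolP|xy] //; apply/eqmodP/asboolP.
Qed.

Lemma to_quotient_repr (x : quotient_group) : to_quotient (repr x) = x.
Proof. exact: reprK. Qed.

Definition quotient_one : quotient_group := to_quotient 1.
Definition quotient_mul (x y : quotient_group) : quotient_group :=
  to_quotient (repr x * repr y).
Definition quotient_inv (x : quotient_group) : quotient_group :=
  to_quotient (repr x)^-1.

Lemma quotient_mulE x y :
  quotient_mul (to_quotient x) (to_quotient y) = to_quotient (x * y).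
Proof.
have [[_ NM NV] NJ] := normal_closureP R.
have /to_quotientP hx := to_quotient_repr (to_quotient x).
have /to_quotientP hy := to_quotient_repr (to_quotient y).
apply/to_quotientP.
have := NM _ _ (NJ _ (repr (to_quotient y)) hx) hy.
by rewrite /conjg invgM -!mulgA mulVKg.
Qed.

Lemma quotient_invE x : quotient_inv (to_quotient x) = to_quotient x^-1.
Proof.
have [[_ NM NV] NJ] := normal_closureP R.
have /to_quotientP hx := to_quotient_repr (to_quotient x).
apply/to_quotientP.
by have := NV _ (NJ _ (repr (to_quotient x))^-1 hx);
  rewrite /conjg !invgM !invgK !mulgA ?mulgVK ?mulgK.
Qed.

Lemma quotient_mulA : associative quotient_mul.
Proof.
move=> x y z; rewrite -[x]to_quotient_repr -[y]to_quotient_repr -[z]to_quotient_repr.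
by rewrite !quotient_mulE mulgA.
Qed.

Lemma quotient_mul1 : left_id quotient_one quotient_mul.
Proof. by move=> x; rewrite -[x]to_quotient_repr quotient_mulE mul1g. Qed.

Lemma quotient_1mul : right_id quotient_one quotient_mul.
Proof. by move=> x; rewrite -[x]to_quotient_repr quotient_mulE mulg1. Qed.

Lemma quotient_mulV : left_inverse quotient_one quotient_inv quotient_mul.
Proof.
by move=> x; rewrite -[x]to_quotient_repr quotient_invE quotient_mulE mulVg.
Qed.

Lemma quotient_Vmul : right_inverse quotient_one quotient_inv quotient_mul.
Proof.
by move=> x; rewrite -[x]to_quotient_repr quotient_invE quotient_mulE mulgV.
Qed.

HB.instance Definition _ := isGroup.Build quotient_group
  quotient_mulA quotient_mul1 quotient_1mul quotient_mulV quotient_Vmul.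

Lemma to_quotientM : {morph to_quotient : x y / x * y}.
Proof. by move=> x y; rewrite -quotient_mulE. Qed.

HB.instance Definition _ :=
  isUMagmaMorphism.Build G quotient_group to_quotient (erefl, to_quotientM).

End QuotientGroup.

Section FreeGroup.
Variable X : choiceType.

(* The letter (x, false) stands for x and (x, true) for its inverse. *)
Definition word := seq (X * bool).

Definition inv_letter (a : X * bool) : X * bool := (a.1, ~~ a.2).

Inductive word_equiv : word -> word -> Prop :=
| WordCancel u a v : word_equiv (u ++ [:: a; inv_letter a] ++ v) (u ++ v)
| WordRefl u : word_equiv u u
| WordSym u v : word_equiv u v -> word_equiv v u
| WordTrans v u w : word_equiv u v -> word_equiv v w -> word_equiv u w.

Definition word_rel : rel word := fun u v => `[< word_equiv u v >].

Lemma word_rel_refl : reflexive word_rel.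
Proof. by move=> u; apply/asboolP; exact: WordRefl. Qed.

Lemma word_rel_sym : symmetric word_rel.
Proof. by move=> u v; apply/asboolP/asboolP; exact: WordSym. Qed.

Lemma word_rel_trans : transitive word_rel.
Proof.
by move=> v u w /asboolP uv /asboolP vw; apply/asboolP; exact: WordTrans uv vw.
Qed.

Canonical word_rel_equiv :=
  EquivRel word_rel word_rel_refl word_rel_sym word_rel_trans.

Definition free_group := {eq_quot word_rel}.
HB.instance Definition _ := Choice.on free_group.
HB.instance Definition _ := Quotient.on free_group.

Definition free_class (u : word) : free_group := \pi_free_group u.

Lemma free_classP u v : free_class u = free_class v <-> word_equiv u v.
Proof. by split=> [/eqmodP/asboolP|uv] //; apply/eqmodP/asboolP. Qed.

Lemma free_class_repr (x : free_group) : free_class (repr x) = x.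
Proof. exact: reprK. Qed.

Definition inv_word (u : word) : word := rev [seq inv_letter a | a <- u].

Lemma inv_letterK : involutive inv_letter.
Proof. by case=> x b; rewrite /inv_letter /= negbK. Qed.

Lemma inv_wordK : involutive inv_word.
Proof. by move=> u; rewrite /inv_word map_rev revK mapK //; exact: inv_letterK. Qed.

Lemma inv_word_cat u v : inv_word (u ++ v) = inv_word v ++ inv_word u.
Proof. by rewrite /inv_word map_cat rev_cat. Qed.

Lemma word_equiv_cat p q u v :
  word_equiv u v -> word_equiv (p ++ u ++ q) (p ++ v ++ q).
Proof.
elim=> {u v} [u a v|u|u v _|v u w _ uv _ vw].
- by have := WordCancel (p ++ u) a (v ++ q); rewrite -!catA.
- exact: WordRefl.
- exact: WordSym.
- exact: WordTrans uv vw.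
Qed.

Lemma word_equiv_cat2 u u' v v' :
  word_equiv u u' -> word_equiv v v' -> word_equiv (u ++ v) (u' ++ v').
Proof.
move=> uu' vv'; apply: (@WordTrans (u' ++ v)).
  exact: (word_equiv_cat [::] v uu').
by have := word_equiv_cat u' [::] vv'; rewrite !cats0.
Qed.

Lemma word_equiv_inv u v : word_equiv u v -> word_equiv (inv_word u) (inv_word v).
Proof.
elim=> {u v} [u a v|u|u v _|v u w _ uv _ vw].
- rewrite !inv_word_cat -!catA.
  have -> : inv_word [:: a; inv_letter a] = [:: a; inv_letter a].
    by rewrite /inv_word /rev /= inv_letterK.
  exact: WordCancel.
- exact: WordRefl.
- exact: WordSym.
- exact: WordTrans uv vw.
Qed.

Lemma word_equiv_mulV u : word_equiv (u ++ inv_word u) [::].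
Proof.
elim: u => [|a u IH] /=; first exact: WordRefl.
rewrite /inv_word map_cons rev_cons -cats1 -/(inv_word u).
apply: (@WordTrans [:: a; inv_letter a]); last exact: (WordCancel [::] a [::]).
by have := word_equiv_cat [:: a] [:: inv_letter a] IH; rewrite -catA.
Qed.

Definition free_one : free_group := free_class [::].
Definition free_mul (x y : free_group) : free_group :=
  free_class (repr x ++ repr y).
Definition free_inv (x : free_group) : free_group := free_class (inv_word (repr x)).

Lemma free_mulE u v : free_mul (free_class u) (free_class v) = free_class (u ++ v).
Proof.
by apply/free_classP; apply: word_equiv_cat2; apply/free_classP; exact: free_class_repr.
Qed.

Lemma free_invE u : free_inv (free_class u) = free_class (inv_word u).
Proof.
by apply/free_classP; apply: word_equiv_inv; apply/free_classP; exact: free_class_repr.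
Qed.

Lemma free_mulA : associative free_mul.
Proof.
move=> x y z; rewrite -[x]free_class_repr -[y]free_class_repr -[z]free_class_repr.
by rewrite !free_mulE catA.
Qed.

Lemma free_1mul : left_id free_one free_mul.
Proof. by move=> x; rewrite -[x]free_class_repr free_mulE. Qed.

Lemma free_mul1 : right_id free_one free_mul.
Proof. by move=> x; rewrite -[x]free_class_repr free_mulE cats0. Qed.

Lemma free_mulV : right_inverse free_one free_inv free_mul.
Proof.
move=> x; rewrite -[x]free_class_repr free_invE free_mulE.
by apply/free_classP; exact: word_equiv_mulV.
Qed.

Lemma free_Vmul : left_inverse free_one free_inv free_mul.
Proof.
move=> x; rewrite -[x]free_class_repr free_invE free_mulE.
apply/free_classP; rewrite -{2}[repr x]inv_wordK; exact: word_equiv_mulV.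
Qed.

HB.instance Definition _ := isGroup.Build free_group
  free_mulA free_1mul free_mul1 free_Vmul free_mulV.

Definition free_gen (x : X) : free_group := free_class [:: (x, false)].

Section Lift.
Variables (G : groupType) (f : X -> G).

Definition eval_letter (a : X * bool) : G := if a.2 then (f a.1)^-1 else f a.1.
Definition eval_word (u : word) : G := \prod_(a <- u) eval_letter a.
Definition free_lift (x : free_group) : G := eval_word (repr x).

Lemma eval_word_equiv u v : word_equiv u v -> eval_word u = eval_word v.
Proof.
rewrite /eval_word; elim=> {u v} [u a v|//|u v _ -> //|v u w _ -> _ -> //].
rewrite !big_cat /= !big_cons big_nil mulg1; congr (_ * _).
by case: a => x [] /=; rewrite /eval_letter /= ?mulVg ?mulgV mul1g.
Qed.

Lemma free_liftE u : free_lift (free_class u) = eval_word u.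
Proof. by apply: eval_word_equiv; apply/free_classP; exact: free_class_repr. Qed.

Lemma free_lift_gen x : free_lift (free_gen x) = f x.
Proof. by rewrite free_liftE /eval_word big_seq1. Qed.

Lemma free_lift1 : free_lift 1 = 1.
Proof. by rewrite (free_liftE [::]) /eval_word big_nil. Qed.

Lemma free_liftM : {morph free_lift : x y / x * y}.
Proof.
move=> x y; rewrite -[x]free_class_repr -[y]free_class_repr.
by rewrite [_ * _]free_mulE !free_liftE /eval_word big_cat.
Qed.

HB.instance Definition _ :=
  isUMagmaMorphism.Build free_group G free_lift (free_lift1, free_liftM).

End Lift.
End FreeGroup.

Definition free_of_finite_rank (F : groupType) : Prop :=
  exists (n : nat) (b : 'I_n -> F), bijective (free_lift b).

Section Presentations.
Variable K : groupType.

(* K = < S | R >: the canonical map from the free group on S to K is onto, and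
   its kernel is the normal closure of R. *)
Definition has_presentation (S : set K) (R : set (free_group S)) : Prop :=
  let p : free_group S -> K := free_lift (fun s : S => val s) in
  range p = setT /\ [set w | p w = 1] = normal_closure R.

Definition raag_generating_set (S : set K) : Prop :=
  exists R : set (free_group S),
    (forall r, R r -> exists s t : S, r = [~ free_gen s, free_gen t]) /\
    has_presentation R.

End Presentations.

Section FreeProduct.
Variables (I : choiceType) (G : I -> groupType).

(* The free group on the disjoint union of the G i, modulo the multiplication
   tables of the G i. *)
Definition free_product_gen (i : I) (x : G i) : free_group {i : I & G i} :=
  free_gen (Tagged (fun i => G i) x).

Definition free_product_relators : set (free_group {i : I & G i}) :=
  [set r | exists (i : I) (x y : G i),
     r = (free_product_gen x * free_product_gen y)^-1 * free_product_gen (x * y)].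

Definition free_product : groupType := quotient_group free_product_relators.

Definition free_product_in (i : I) (x : G i) : free_product :=
  to_quotient free_product_relators (free_product_gen x).

Lemma free_product_inM i : {morph @free_product_in i : x y / x * y}.
Proof.
move=> x y; rewrite /free_product_in -to_quotientM; apply/esym/to_quotientP.
by apply: sub_normal_closure; exists i, x, y.
Qed.

Lemma free_product_in1 i : @free_product_in i 1 = 1.
Proof.
have := free_product_inM (1 : G i) 1; rewrite mulg1.
by move/(congr1 (fun z => z / free_product_in (1 : G i))); rewrite mulgV mulgK.
Qed.

HB.instance Definition _ i := isUMagmaMorphism.Build (G i) free_product
  (@free_product_in i) (@free_product_in1 i, @free_product_inM i).

End FreeProduct.

Record star_graph_of_groups (m : nat) := StarGraphOfGroups {
  central_group : groupType;
  leaf_group : 'I_m -> groupType;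
  edge_group : 'I_m -> groupType;
  alpha : forall i, {hom edge_group i -> central_group};
  omega : forall i, {hom edge_group i -> leaf_group i};
  alpha_inj : forall i, injective (alpha i);
  omega_inj : forall i, injective (omega i)
}.

Section StarFundamentalGroup.
Variables (m : nat) (GG : star_graph_of_groups m).

(* The vertices of the star: None is the centre, Some i the i-th leaf. *)
Definition vertex_group (v : option 'I_m) : groupType :=
  if v is Some i then leaf_group GG i else central_group GG.

Definition central_in (x : central_group GG) : free_product vertex_group :=
  @free_product_in _ vertex_group None x.

Definition leaf_in (i : 'I_m) (x : leaf_group GG i) : free_product vertex_group :=
  @free_product_in _ vertex_group (Some i) x.

Definition edge_relators : set (free_product vertex_group) :=
  [set r | exists (i : 'I_m) (g : edge_group GG i),
     r = (central_in (alpha GG i g))^-1 * leaf_in (omega GG i g)].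

Definition star_pi1 : groupType := quotient_group edge_relators.

End StarFundamentalGroup.

Definition Z_linear (G : groupType) : Prop :=
  exists (n : nat) (rho : G -> 'M[int]_n),
    [/\ forall g, rho g \in unitmx,
        rho 1 = 1%:M%R,
        forall g h, rho (g * h) = (rho g *m rho h)%R
      & injective rho].

(* Main.v *)
From HB Require Import structures.
From mathcomp Require Import fingroup perm cyclic gproduct.
From mathcomp Require Import all_boot all_order all_algebra.
From mathcomp Require Import boolp classical_sets cardinality.
From mathcomp Require Import zify.
Require Import Defs.

(** Write F for the central free group, w_i for the image in F of the chosen
generator of the i-th edge group and s_i for its image in the i-th leaf.  Then
G is generated by F and the letters of the leaves other than the s_i; its
relations say that two letters of a leaf commute when they do in the leaf, and
that a letter commuting with s_i commutes with w_i.

Let Q be a finite quotient of F.  Consider the finite graph whose vertices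
(walls) are the edges of the Cayley graph of Q and the pairs (l, C) of a letter
l and a coset C in Q of the image of P_l, where P_l = <w_i> if l commutes with
s_i and P_l = 1 otherwise.  Let T_l be the P_l-invariant path through 1 in F
that reads the letters of w_i over and over (T_l = {1} if P_l = 1).  An edge is
adjacent to (l, C) if it lies on a translate of T_l by an element of C, and
(l, C) is adjacent to (l', C') if l commutes with l' and C meets C'.  Then Q acts on the
right-angled Artin group A of this graph, and b |-> (edge from 1 to b) b,
l |-> (l, P_l) defines a homomorphism from G to the semidirect product of A and
Q.  It is modelled on the map from a special cube complex to a Salvetti complex.

The homomorphism is injective if Q separates from each <w_i> the finitely many
elements v v'^-1, with v and v' prefixes of w_i, that do not belong to it.
Indeed G is also generated by the elements of the basis of F and the conjugates
t^-1 l t with t in T_l, and each of these is sent to one letter of A times an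
element of Q.  If two letters of the image of a word cancel in A, then
separation shows that the corresponding letters of the word cancel in G
([shorten_word]); so a shortest word for an element of G is sent to a reduced
word.  Such a Q exists because cyclic subgroups of a free group are separable
([cyclics_separable], by Marshall Hall's argument).

It remains to represent the semidirect product over the integers.  Each
generator of A is written as a product of two reflections in a right-angled
Coxeter group, which acts on an integral lattice permuted by Q.  A reduced word
sends the vector with all coordinates 1 to a vector with a negative coordinate
([artin_word_descents]), whereas Q fixes the former vector; so no nonempty
reduced word acts as an element of Q ([reduced_word_faithful]). *)

Set Implicit Arguments.
Unset Strict Implicit.
Unset Printing Implicit Defensive.

Import Order.TTheory GRing.Theory Num.Theory.
Local Open Scope classical_set_scope.
Local Open Scope group_scope.

(** * Groups of additive automorphisms *)

Section AutomorphismGroup.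
Variable V : zmodType.

Record automorphism := Automorphism {
  aut_fun : V -> V;
  aut_inv : V -> V;
  autD : {morph aut_fun : v w / (v + w)%R};
  aut_funK : cancel aut_fun aut_inv;
  aut_invK : cancel aut_inv aut_fun }.

HB.instance Definition _ := gen_eqMixin automorphism.
HB.instance Definition _ := gen_choiceMixin automorphism.

Lemma aut_eq (f g : automorphism) : aut_fun f =1 aut_fun g -> f = g.
Proof.
case: f g => [f f' fD fK f'K] [g g' gD gK g'K] /= /funext fg; subst g.
have f'g' : f' = g' by apply: funext => v; rewrite -{1}[v]g'K fK.
by subst g'; congr Automorphism; exact: Prop_irrelevance.
Qed.

Definition aut_one : automorphism :=
  @Automorphism id id (fun _ _ => erefl) (fun=> erefl) (fun=> erefl).

Lemma aut_mulD (f g : automorphism) :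
  {morph aut_fun g \o aut_fun f : v w / (v + w)%R}.
Proof. by move=> v w /=; rewrite !autD. Qed.

(* Automorphisms act on the right: the left factor is applied first. *)
Definition aut_mul (f g : automorphism) : automorphism :=
  Automorphism (@aut_mulD f g) (can_comp (@aut_funK g) (@aut_funK f))
    (can_comp (@aut_invK f) (@aut_invK g)).

Lemma aut_invD (f : automorphism) : {morph aut_inv f : v w / (v + w)%R}.
Proof.
by move=> v w; rewrite -{1}[v](aut_invK f) -{1}[w](aut_invK f) -autD aut_funK.
Qed.

Definition aut_V (f : automorphism) : automorphism :=
  Automorphism (@aut_invD f) (@aut_invK f) (@aut_funK f).

Lemma aut_mulA : associative aut_mul.
Proof. by move=> f g h; apply: aut_eq. Qed.
Lemma aut_1mul : left_id aut_one aut_mul.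
Proof. by move=> f; apply: aut_eq. Qed.
Lemma aut_mul1 : right_id aut_one aut_mul.
Proof. by move=> f; apply: aut_eq. Qed.
Lemma aut_Vmul : left_inverse aut_one aut_V aut_mul.
Proof. by move=> f; apply: aut_eq => v /=; rewrite aut_invK. Qed.
Lemma aut_mulV : right_inverse aut_one aut_V aut_mul.
Proof. by move=> f; apply: aut_eq => v /=; rewrite aut_funK. Qed.

HB.instance Definition _ := isGroup.Build automorphism
  aut_mulA aut_1mul aut_mul1 aut_Vmul aut_mulV.

Lemma autM (f g : automorphism) v : aut_fun (f * g) v = aut_fun g (aut_fun f v).
Proof. by []. Qed.

Lemma aut1 v : aut_fun 1 v = v.
Proof. by []. Qed.

End AutomorphismGroup.

(** * Linearity from a faithful action on a lattice *)

Section FaithfulAction.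
Variables (U : finType) (G : groupType).
Local Notation V := {ffun U -> int}.
Variable rho : {hom G -> automorphism V}.

Definition basis_vector (u : U) : V := [ffun z => (z == u)%:R%R].

(** An additive map is determined by the basis vectors; this is what allows
matrices to replace automorphisms. *)
Lemma aut_sum (f : automorphism V) (v : V) z :
  aut_fun f v z = (\sum_u v u * aut_fun f (basis_vector u) z)%R.
Proof.
have f0 : aut_fun f 0%R = 0%R.
  by apply: (@addrI _ (aut_fun f 0%R)); rewrite -autD !addr0.
have fN w : aut_fun f (- w)%R = (- aut_fun f w)%R.
  by apply: (@addrI _ (aut_fun f w)); rewrite -autD !subrr.
have fn w n : aut_fun f (w *+ n)%R = (aut_fun f w *+ n)%R.
  by elim: n => [|n IH]; rewrite ?mulr0n // !mulrS autD IH.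
have fz w (k : int) : aut_fun f (w *~ k)%R = (aut_fun f w *~ k)%R.
  by case: k => n; rewrite ?NegzE ?mulrNz -!pmulrn ?fN fn.
have {1}-> : v = (\sum_u basis_vector u *~ v u)%R.
  apply/ffunP => y; rewrite sum_ffunE (bigD1 y) //= big1 ?addr0 => [|u uy].
    by rewrite ffunMzE ffunE eqxx; lia.
  by rewrite ffunMzE ffunE eq_sym (negbTE uy) mul0rz.
rewrite (big_morph (aut_fun f) (@autD _ f) f0) sum_ffunE.
by apply: eq_bigr => u _; rewrite fz ffunMzE -mulrzr intz mulrC.
Qed.

Lemma Z_linear_of_action : (forall g, rho g = 1 -> g = 1) -> Z_linear G.
Proof.
move=> rho_ker.
pose M (f : automorphism V) : 'M[int]_#|U| :=
  (\matrix_(i, j) aut_fun f (basis_vector (enum_val i)) (enum_val j))%R.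
have MM f g : M (f * g) = (M f *m M g)%R.
  apply/matrixP => i j; rewrite !mxE autM aut_sum.
  rewrite (reindex _ (onW_bij _ (@enum_val_bij U))) /=.
  by apply: eq_bigr => k _; rewrite !mxE.
have M1 : M 1 = 1%:M%R.
  by apply/matrixP => i j; rewrite !mxE aut1 ffunE (inj_eq enum_val_inj) eq_sym.
exists #|U|, (fun g => M (rho g)); split.
- move=> g; apply: (mulmx1_unit (B := M (rho g^-1)) _).1.
  by rewrite -MM -gmulfM mulgV gmulf1 M1.
- by rewrite gmulf1.
- by move=> g h; rewrite gmulfM MM.
- move=> g h Mgh; apply: divg1_eq; apply: rho_ker.
  rewrite gmulfM gmulfV; apply/eqP; rewrite divg_eq1; apply/eqP; apply: aut_eq => v.
  apply/ffunP => z; rewrite (aut_sum (rho g)) (aut_sum (rho h)).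
  apply: eq_bigr => u _; congr (_ * _)%R.
  by have := congr1 (fun A : 'M_ _ => A (enum_rank u) (enum_rank z)) Mgh; rewrite !mxE !enum_rankK.
Qed.

End FaithfulAction.

(** * A reflection representation of right-angled Artin groups *)

Section Reflections.
Variables (D : finType) (adj : rel D).
Hypothesis adj_irr : irreflexive adj.
Hypothesis adj_sym : symmetric adj.
Local Notation U := (D * bool)%type.
Local Notation V := {ffun U -> int}.

(** The geometric representation of the right-angled Coxeter group on D * bool,
on coordinates dual to the simple roots, for the bilinear form that is 0 on
commuting pairs and -1 on the others; the factor 2 keeps it integral. *)
Definition reflect_fun (u : U) (v : V) : V :=
  [ffun z => if z == u then (- v u)%R
             else if adj u.1 z.1 then v z else (v z + 2%:Z * v u)%R].

Lemma reflect_funD u : {morph reflect_fun u : v w / (v + w)%R}.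
Proof.
move=> v w; apply/ffunP => z; rewrite !ffunE.
by case: ifP => _; [|case: ifP => _]; rewrite /=; lia.
Qed.

Lemma reflect_funK u : cancel (reflect_fun u) (reflect_fun u).
Proof.
move=> v; apply/ffunP => z; rewrite !ffunE eqxx.
by case: eqP => [->|_]; rewrite ?opprK //; case: (adj u.1 z.1) => //; rewrite mulrN addrK.
Qed.

Definition reflection u : automorphism V :=
  Automorphism (@reflect_funD u) (@reflect_funK u) (@reflect_funK u).

Lemma reflectionK u : reflection u * reflection u = 1.
Proof. by apply: aut_eq => v; rewrite autM /= reflect_funK. Qed.

Lemma reflection_commute u z : adj u.1 z.1 -> commute (reflection u) (reflection z).
Proof.
move=> uz; apply: aut_eq => v; apply/ffunP => y; rewrite !autM /=.
have zu : adj z.1 u.1 by rewrite adj_sym.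
have nzu : (z == u) = false by apply: contraTF uz => /eqP ->; rewrite adj_irr.
have uvz : reflect_fun u v z = v z by rewrite ffunE nzu uz.
have zvu : reflect_fun z v u = v u by rewrite ffunE eq_sym nzu zu.
rewrite [LHS]ffunE [RHS]ffunE uvz zvu !ffunE.
case: (y =P z) => [->|_]; first by rewrite nzu uz.
case: (y =P u) => [->|_]; first by rewrite zu.
by case: (adj z.1 y.1); case: (adj u.1 y.1) => //; rewrite addrAC.
Qed.

(** The two reflections attached to x : D generate an infinite dihedral group,
in which their product is a translation; it represents the Artin generator x,
and the product in the other order represents x^-1. *)
Definition artin_letter (a : D * bool) : automorphism V :=
  reflection a * reflection (inv_letter a).

Lemma artin_letterV a : (artin_letter a)^-1 = artin_letter (inv_letter a).
Proof.
apply: mulg1_eq; rewrite /artin_letter inv_letterK mulgA.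
by rewrite -(mulgA (reflection a)) reflectionK mulg1 reflectionK.
Qed.

Lemma artin_letter_commute a b : adj a.1 b.1 -> commute (artin_letter a) (artin_letter b).
Proof.
by move=> ab; apply: commuteM; apply/commute_sym; apply: commuteM;
  apply: reflection_commute; rewrite //= adj_sym.
Qed.

Definition artin_word (s : seq (D * bool)) : automorphism V :=
  \prod_(a <- s) artin_letter a.

(** The invariant of the ping-pong: it holds in the chambers that reduced words
reach, whose descents are the negative coordinates.  It forces two descents to
commute, since the sum of their coordinates is negative. *)
Definition negatives_dominated (v : V) : Prop :=
  (forall u, v u <> 0%R) /\
  forall u z, (v u < 0)%R -> z != u -> ~~ adj u.1 z.1 -> (0 < v u + v z)%R.

(** A reflection in a positive coordinate u creates the descent u and keeps the
old descents that commute with u.  A descent z that does not commute with u is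
lost because domination makes v z + 2 v u positive. *)
Lemma negatives_dominated_reflection u v :
  negatives_dominated v -> (0 < v u)%R ->
  negatives_dominated (aut_fun (reflection u) v) /\
  forall z, (aut_fun (reflection u) v z < 0)%R <->
            z = u \/ (v z < 0)%R /\ adj u.1 z.1.
Proof.
move=> [nz dom] vu.
have neg z : (aut_fun (reflection u) v z < 0)%R <-> z = u \/ (v z < 0)%R /\ adj u.1 z.1.
  rewrite /= ffunE; case: eqP => [->|/eqP zu]; first by split=> _; [left|lia].
  case: ifP => uz; first by split=> [?|[/eqP|[]//]]; [right|rewrite (negbTE zu)].
  split=> [vz|[/eqP|[_ //]]]; last by rewrite (negbTE zu).
  have vz0 : (v z < 0)%R by have := nz z; lia.
  have := dom z u vz0; rewrite eq_sym zu adj_sym uz => /(_ isT isT); lia.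
split=> //; split=> [z|w z /neg wN zw nwz].
  rewrite /= ffunE; case: eqP => [_|/eqP zu]; first by have := nz u; lia.
  case: ifP => uz; first exact: nz.
  case: (ltrP (v z) 0%R) => vz; last by lia.
  have := dom z u vz; rewrite eq_sym zu adj_sym uz => /(_ isT isT); lia.
case: wN => [wu|[vw uw]].
  subst w; rewrite /= !ffunE eqxx (negbTE zw) (negbTE nwz).
  case: (ltrP (v z) 0%R) => vz; last by have := nz z; lia.
  have := dom z u vz; rewrite eq_sym zw adj_sym nwz => /(_ isT isT); lia.
have wu : w != u by apply: contraTneq uw => ->; rewrite adj_irr.
have zu : z != u by apply: contraNneq nwz => ->; rewrite adj_sym.
have := dom w z vw zw nwz.
by rewrite /= !ffunE (negbTE wu) (negbTE zu) uw; case: ifP => _; lia.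
Qed.

Lemma negatives_dominated_letter a v :
  negatives_dominated v -> (0 < v a)%R ->
  negatives_dominated (aut_fun (artin_letter a) v) /\
  forall z, (aut_fun (artin_letter a) v z < 0)%R <->
            z = inv_letter a \/ (v z < 0)%R /\ adj a.1 z.1.
Proof.
move=> dv va; rewrite /artin_letter autM.
have [dv' neg'] := negatives_dominated_reflection dv va.
(* The second reflection is again in a positive coordinate, as the only descents
   are now a, which differs from inv_letter a, and descents commuting with a. *)
have va' : (0 < aut_fun (reflection a) v (inv_letter a))%R.
  rewrite lt_neqAle eq_sym leNgt; apply/andP; split; first exact/eqP/dv'.1.
  apply/negP => /neg' [|[_]]; last by rewrite adj_irr.
  by case: a {va dv' neg'} => x [].
have [dv'' neg''] := negatives_dominated_reflection dv' va'.
split=> // z; split=> [/neg'' [->|[/neg' [->|[vz _]] az]]|[->|[vz az]]].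
- by left.
- by rewrite adj_irr in az.
- by right.
- by apply/neg''; left.
- by apply/neg''; right; split=> //; apply/neg'; right.
Qed.

Definition has_cancelling_pair (s : seq (D * bool)) : Prop :=
  exists s1 a s2 s3, s = s1 ++ a :: s2 ++ inv_letter a :: s3 /\
                     all (fun b => adj a.1 b.1) s2.

Definition base_vector : V := [ffun=> 1%R].

(** A negative coordinate records a letter of the word that can be moved to its
end.  If appending a letter were to undo such a descent, the two letters would
cancel; so each letter of a reduced word reflects in positive coordinates, and
the last one leaves a negative coordinate. *)
Lemma artin_word_descents s : ~ has_cancelling_pair s ->
  let v := aut_fun (artin_word s) base_vector in
  [/\ negatives_dominated v,
      forall z, (v z < 0)%R -> exists s1 a s2,
        [/\ s = s1 ++ a :: s2, all (fun b => adj a.1 b.1) s2 & z = inv_letter a]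
    & s != [::] -> exists z, (v z < 0)%R].
Proof.
elim/last_ind: s => [|s a IH] red /=.
  rewrite /artin_word big_nil aut1; split=> //; last by move=> z; rewrite ffunE.
  by split=> [u|u z]; rewrite !ffunE.
have red' : ~ has_cancelling_pair s.
  move=> [s1 [b [s2 [s3 [e sb]]]]]; apply: red.
  by exists s1, b, s2, (rcons s3 a); rewrite e -!cats1 -!catA /= -catA.
have {IH red'} [dom desc _] := IH red'.
have -> : artin_word (rcons s a) = artin_word s * artin_letter a.
  by rewrite /artin_word -cats1 big_cat big_seq1.
rewrite autM; set v := aut_fun _ _ in dom desc *.
have va : (0 < v a)%R.
  rewrite lt_neqAle eq_sym leNgt; apply/andP; split; first exact/eqP/dom.1.
  apply/negP => /desc [s1 [b [s2 [e sb ab]]]]; rewrite ab in red; apply: red.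
  by exists s1, b, s2, [::]; rewrite e -cats1 -catA.
have [dom' neg] := negatives_dominated_letter dom va.
split=> // [z /neg [->|[/desc [s1 [b [s2 [-> sb ->]]]] az]]|_].
- by exists s, a, [::]; rewrite cats1.
- exists s1, b, (rcons s2 a); rewrite rcons_cat rcons_cons all_rcons sb.
  by rewrite adj_sym az.
- by exists (inv_letter a); apply/neg; left.
Qed.
End Reflections.

Section Relabelling.
Variables (D : finType) (adj : rel D).
Variables (Q : groupType) (act : Q -> D -> D).
Hypothesis act1 : forall x, act 1 x = x.
Hypothesis actM : forall p q x, act (p * q) x = act p (act q x).
Hypothesis act_adj : forall q x y, adj (act q x) (act q y) = adj x y.
Local Notation V := {ffun D * bool -> int}.

(** Acting by substitution on the right makes [relabel] a homomorphism for the
right composition of automorphisms. *)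
Definition relabel_fun (q : Q) (v : V) : V := [ffun z => v (act q z.1, z.2)].

Lemma relabel_funD q : {morph relabel_fun q : v w / (v + w)%R}.
Proof. by move=> v w; apply/ffunP => z; rewrite !ffunE. Qed.

Lemma relabel_funM p q v : relabel_fun q (relabel_fun p v) = relabel_fun (p * q) v.
Proof. by apply/ffunP => z; rewrite !ffunE actM. Qed.

Lemma relabel_fun1 v : relabel_fun 1 v = v.
Proof. by apply/ffunP => -[x b]; rewrite !ffunE act1. Qed.

Lemma relabel_funK q : cancel (relabel_fun q) (relabel_fun q^-1).
Proof. by move=> v; rewrite relabel_funM mulgV relabel_fun1. Qed.

Lemma relabel_funVK q : cancel (relabel_fun q^-1) (relabel_fun q).
Proof. by move=> v; rewrite relabel_funM mulVg relabel_fun1. Qed.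

Definition relabel q : automorphism V :=
  Automorphism (@relabel_funD q) (@relabel_funK q) (@relabel_funVK q).

Lemma relabelM p q : relabel (p * q) = relabel p * relabel q.
Proof. by apply: aut_eq => v; rewrite autM /= relabel_funM. Qed.

Lemma relabel1 : relabel 1 = 1.
Proof. by apply: aut_eq => v; rewrite /= relabel_fun1. Qed.

Lemma act_inj q : injective (act q).
Proof. by apply: (can_inj (g := act q^-1)) => x; rewrite -actM mulVg act1. Qed.

Lemma relabel_reflection q u :
  relabel q * reflection adj u = reflection adj (act q u.1, u.2) * relabel q.
Proof.
case: u => x b; apply: aut_eq => v; apply/ffunP => -[y c]; rewrite !autM /= !ffunE /=.
by rewrite !xpair_eqE (inj_eq (@act_inj q)) act_adj.
Qed.

Lemma relabel_artin_letter q a :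
  relabel q * artin_letter adj a = artin_letter adj (act q a.1, a.2) * relabel q.
Proof.
by rewrite /artin_letter mulgA relabel_reflection -mulgA relabel_reflection mulgA.
Qed.

(** Relabelling fixes [base_vector], and a nonempty reduced word does not. *)
Lemma reduced_word_faithful s q : irreflexive adj -> symmetric adj ->
  ~ has_cancelling_pair adj s -> artin_word adj s * relabel q = 1 -> s = [::].
Proof.
move=> adj_irr adj_sym red eq1; case: (s =P [::]) => // /eqP s0.
have [_ _ /(_ s0) [z neg]] := artin_word_descents adj_irr adj_sym red.
have base_fix : aut_fun (relabel q^-1) (base_vector D) = base_vector D.
  by apply/ffunP => y; rewrite !ffunE.
have ws : artin_word adj s = relabel q^-1.
  by apply: (mulIg (relabel q)); rewrite eq1 -relabelM mulVg relabel1.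
by move: neg; rewrite ws base_fix ffunE.
Qed.

End Relabelling.

(** * Embedding an amalgam into a semidirect product by a finite group *)

(** The free group acts on its Cayley tree; the letter l is supported by the
connected set T l of vertices, on which a subgroup P l that centralizes l acts.
The hypothesis [T_sep] says that Q is fine enough: if l' is l or adjacent to l,
an element of the kernel of pi that moves a point of T l into T l' belongs to P l
or to P l'. *)
Section Amalgam.
Variables (B : finType) (Q : finGroupType) (pi : {hom free_group B -> Q}).
Variables (L : finType) (adjL : rel L) (P T : L -> set (free_group B)).
Local Notation Fr := (free_group B).
Hypothesis adjL_irr : irreflexive adjL.
Hypothesis adjL_sym : symmetric adjL.
Hypothesis P_sub : forall l, is_subgroup (P l).
Hypothesis T1 : forall l, T l 1.
Hypothesis PT : forall l p x, P l p -> T l x -> T l (p * x).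
Hypothesis T_conn : forall l (Z : set Fr), Z 1 ->
  (forall x b, T l x -> T l (x * free_gen b) -> (Z x <-> Z (x * free_gen b))) ->
  T l `<=` Z.
Hypothesis T_sep : forall l l' z z', l = l' \/ adjL l l' -> T l z -> T l' z' ->
  pi z = pi z' -> P l (z' * z^-1) \/ P l' (z' * z^-1).

Definition coset (l : L) (x : Fr) : {set Q} :=
  [set q | `[< exists2 p, P l p & q = pi (x * p) >]]%SET.

(** The vertices of the graph of the Artin group: (q, b) stands for the edge from
q to q b of the Cayley graph of Q, and (l, C) for a translate of T l. *)
Definition wall := (Q * B + L * {set Q})%type.

Definition wall_adj (x y : wall) : bool :=
  match x, y with
  | inl _, inl _ => false
  | inl (q, b), inr (l, C) | inr (l, C), inl (q, b) =>
      `[< exists2 t, T l t /\ T l (t * free_gen b) & q * (pi t)^-1 \in C >]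
  | inr (l, C), inr (l', C') => adjL l l' && [exists c, (c \in C) && (c \in C')]
  end.

Definition translate (q : Q) (C : {set Q}) : {set Q} := [set r | q^-1 * r \in C]%SET.

Lemma mem_translate q C r : (q * r \in translate q C) = (r \in C).
Proof. by rewrite inE mulKg. Qed.

Definition wall_act (q : Q) (x : wall) : wall :=
  match x with
  | inl (q', b) => inl (q * q', b)
  | inr (l, C) => inr (l, translate q C)
  end.

Lemma wall_adj_irr : irreflexive wall_adj.
Proof. by case=> [[q b]|[l C]] //=; rewrite adjL_irr. Qed.

Lemma wall_adj_sym : symmetric wall_adj.
Proof.
case=> [[q b]|[l C]] [[q' b']|[l' C']] //=; rewrite adjL_sym; congr (_ && _).
by apply: eq_existsb => c; rewrite andbC.
Qed.

Lemma wall_act1 x : wall_act 1 x = x.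
Proof.
case: x => [[q b]|[l C]] /=; first by rewrite mul1g.
by congr (inr (_, _)); apply/setP => r; rewrite inE invg1 mul1g.
Qed.

Lemma wall_actM p q x : wall_act (p * q) x = wall_act p (wall_act q x).
Proof.
case: x => [[r b]|[l C]] /=; first by rewrite mulgA.
by congr (inr (_, _)); apply/setP => r; rewrite !inE invgM mulgA.
Qed.

Lemma wall_act_adj q x y : wall_adj (wall_act q x) (wall_act q y) = wall_adj x y.
Proof.
case: x y => [[r b]|[l C]] [[r' b']|[l' C']] //=.
- by congr (asbool _); apply: propext; split=> -[t Tt] rC; exists t => //;
    move: rC; rewrite -mulgA mem_translate.
- by congr (asbool _); apply: propext; split=> -[t Tt] rC; exists t => //;
    move: rC; rewrite -mulgA mem_translate.
congr (_ && _); apply/existsP/existsP => -[c /andP[cC cC']].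
  by exists (q^-1 * c); rewrite inE in cC; rewrite inE in cC'; rewrite cC.
by exists (q * c); rewrite !mem_translate cC.
Qed.

Lemma P1 l : P l 1. Proof. by case: (P_sub l). Qed.
Lemma PM l x y : P l x -> P l y -> P l (x * y). Proof. by case: (P_sub l) => _ + _; apply. Qed.
Lemma PV l x : P l x -> P l x^-1. Proof. by case: (P_sub l) => _ _; apply. Qed.

Lemma cosetP l x q : reflect (exists2 p, P l p & q = pi (x * p)) (q \in coset l x).
Proof. by rewrite inE; apply: asboolP. Qed.

Lemma coset_act l x y : translate (pi x) (coset l y) = coset l (x * y).
Proof.
apply/setP => q; rewrite inE; apply/cosetP/cosetP => -[p Pp e]; exists p => //.
  by rewrite -mulgA gmulfM -e mulVKg.
by rewrite e -mulgA gmulfM mulKg.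
Qed.

Lemma coset_mulr l x p : P l p -> coset l (x * p) = coset l x.
Proof.
move=> Pp; apply/setP => q; apply/cosetP/cosetP => -[p' Pp' ->].
  by exists (p * p'); rewrite ?mulgA //; exact: PM.
by exists (p^-1 * p'); [exact: PM (PV Pp) Pp' | rewrite mulgA mulgK].
Qed.

Definition step (b : B) (e : bool) : Fr := eval_letter (@free_gen B) (b, e).

Lemma stepN b e : step b (~~ e) = (step b e)^-1.
Proof. by case: e; rewrite /step /eval_letter //= invgK. Qed.

(** [Turn l t e] stands for the conjugate by t of the letter l or its inverse.
Having all t in T l as letters, and not only t = 1, is what makes words that are
shortest in G reduced in the Artin group: a conjugate b l b^-1 that slides along
T l is a single letter. *)
Inductive letter := Move of B & bool | Turn of L & Fr & bool.

Definition displacement (x : letter) : Fr := if x is Move b e then step b e else 1.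
Definition displacements (s : seq letter) : Fr := \prod_(x <- s) displacement x.

Definition valid (x : letter) : Prop := if x is Turn l t _ then T l t else True.
Fixpoint valid_word (s : seq letter) : Prop :=
  if s is x :: s' then valid x /\ valid_word s' else True.

Lemma valid_cat s s' : valid_word (s ++ s') <-> valid_word s /\ valid_word s'.
Proof. by elim: s => [|x s IH] /=; tauto. Qed.

(** The Artin letter that a letter contributes when it is read at the position f
of the free group; an inverse edge is labelled by its origin, which is where it
ends. *)
Definition label (f : Fr) (x : letter) : wall * bool :=
  match x with
  | Move b e => (inl (pi (if e then f * step b e else f), b), e)
  | Turn l t e => (inr (l, coset l (f * t^-1)), e)
  end.

Fixpoint labels (f : Fr) (s : seq letter) : seq (wall * bool) :=
  if s is x :: s' then label f x :: labels (f * displacement x) s' else [::].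

Lemma label_Move_back f b e :
  (label f (Move b e)).1 = (label (f * step b e) (Move b (~~ e))).1.
Proof. by case: e; rewrite /= // ?stepN ?(stepN b false) ?mulgK. Qed.

Lemma displacements_cons x s : displacements (x :: s) = displacement x * displacements s.
Proof. by rewrite /displacements big_cons. Qed.

Lemma labels_cat f s l1 l2 : labels f s = l1 ++ l2 ->
  exists s1 s2, [/\ s = s1 ++ s2, labels f s1 = l1
                  & labels (f * displacements s1) s2 = l2].
Proof.
elim: l1 f s => [|a l1 IH] f s.
  by exists [::], s; rewrite /displacements big_nil mulg1.
case: s => [//|x s] /= [<- /IH[s1 [s2 [-> <- <-]]]].
by exists (x :: s1), s2; rewrite displacements_cons mulgA.
Qed.

(** An edge whose wall is adjacent to the wall of a translate of T l, and that
starts on that translate, stays on it: separation lifts the adjacency, which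
holds in Q, to the free group. *)
Lemma edge_step l tau g b e : T l tau ->
  wall_adj (label g (Move b e)).1 (inr (l, coset l (g * tau^-1))) ->
  T l (tau * step b e).
Proof.
move=> Ttau /asboolP [t [Tt Ttb] /cosetP [p Pp]].
move=> eg; have {eg} : pi tau = pi (p * (if e then t * free_gen b else t)).
  have := congr1 (fun q => pi (tau * g^-1) * q * pi t) eg.
  case: e {eg}; rewrite /step /eval_letter /= -gmulfV -!gmulfM ?gnorm // => eg.
  have := congr1 (fun q => q * pi (free_gen b)) eg.
  by rewrite -!gmulfM !gnorm.
move/esym; have Tt' : T l (if e then t * free_gen b else t) by case: e.
move=> /(T_sep (or_introl (erefl l)) (PT Pp Tt') Ttau) Pn.
have {}Pn : P l (tau * (p * (if e then t * free_gen b else t))^-1) by case: Pn.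
have -> : tau * step b e = tau * (p * (if e then t * free_gen b else t))^-1 *
  (p * (if e then t else t * free_gen b)).
  by case: e {Tt' Pn}; rewrite /step /eval_letter /= !gnorm.
by apply: PT Pn _; apply: PT Pp _; case: e {Tt'}.
Qed.

Variables (G : groupType) (phi : {hom Fr -> G}) (a : L -> G).
Hypothesis P_commute : forall l p, P l p -> commute (phi p) (a l).
Hypothesis adj_commute : forall l l', adjL l l' -> commute (a l) (a l').
Hypothesis G_generated : forall S : set G, is_subgroup S ->
  (forall b, S (phi (free_gen b))) -> (forall l, S (a l)) -> forall g, S g.
Hypothesis G_universal : forall (H : groupType) (h : B -> H) (k : L -> H),
  (forall l p, P l p -> commute (free_lift h p) (k l)) ->
  (forall l l', adjL l l' -> commute (k l) (k l')) ->
  exists rho : {hom G -> H},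
    (forall x, rho (phi x) = free_lift h x) /\ (forall l, rho (a l) = k l).

Definition signed (x : G) (e : bool) : G := if e then x^-1 else x.

Lemma signedN x e : signed x (~~ e) = (signed x e)^-1.
Proof. by case: e => //=; rewrite invgK. Qed.

Lemma signedJ x y e : signed x e ^ y = signed (x ^ y) e.
Proof. by case: e => //=; rewrite conjVg. Qed.

Lemma commute_signed x y e e' : commute x y -> commute (signed x e) (signed y e').
Proof.
move=> xy; have xy' : commute x (signed y e') by case: e' => //; exact: commuteV.
by case: e => //; apply/commute_sym/commuteV/commute_sym.
Qed.

Definition value (x : letter) : G :=
  match x with
  | Move b e => phi (step b e)
  | Turn l t e => signed (a l) e ^ phi t
  end.
Definition word_value (s : seq letter) : G := \prod_(x <- s) value x.

Lemma word_value_cons x s : word_value (x :: s) = value x * word_value s.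
Proof. by rewrite /word_value big_cons. Qed.

Lemma word_value_cat s s' : word_value (s ++ s') = word_value s * word_value s'.
Proof. by rewrite /word_value big_cat. Qed.

Lemma value_Turn_P l t p e : P l p -> value (Turn l (p * t) e) = value (Turn l t e).
Proof.
move=> Pp; rewrite /= gmulfM conjgM; congr (_ ^ _).
by rewrite signedJ conjgE -(P_commute Pp) mulKg.
Qed.

Lemma value_Turn_step l t b e e' :
  value (Turn l t e) * phi (step b e') = phi (step b e') * value (Turn l (t * step b e') e).
Proof. by rewrite conjgC /= gmulfM conjgM. Qed.

(** A turn moves past a word whose walls are all adjacent to its wall.  A move
stays on the translate of T l by [edge_step], so it only changes the conjugating
element; a turn of another letter l' commutes, since separation provides a point
common to both translates, where the two turns are conjugates of l and l' by the
same element. *)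
Lemma turn_past s l f tau e :
  T l tau -> valid_word s ->
  all (fun c => wall_adj (inr (l, coset l (f * tau^-1))) c.1) (labels f s) ->
  T l (tau * displacements s) /\
  value (Turn l tau e) * word_value s =
    word_value s * value (Turn l (tau * displacements s) e).
Proof.
elim: s f tau => [|x s IH] f tau Ttau.
  by rewrite /displacements /word_value !big_nil !mulg1 mul1g.
rewrite displacements_cons word_value_cons !mulgA => -[vx vs] /andP[adjx].
have -> : f * tau^-1 = f * displacement x * (tau * displacement x)^-1.
  by rewrite invgM mulgA mulgK.
move=> adjs.
have [Tx comx] : T l (tau * displacement x) /\
   value (Turn l tau e) * value x = value x * value (Turn l (tau * displacement x) e).
  case: x vx adjx {adjs} => [b e'|l' t e'] vx.
    by rewrite wall_adj_sym => /(edge_step Ttau) Tb; rewrite value_Turn_step.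
  rewrite /= => /andP[ll' /existsP [q /andP[/cosetP[p Pp ->] /cosetP[p' Pp' eq]]]].
  rewrite mulg1; split=> //.
  have eq' : pi (p^-1 * tau) = pi (p'^-1 * t).
    apply: (can_inj invgK); rewrite -!gmulfV !invgM !invgK; move: eq.
    by rewrite -!(mulgA f) !(gmulfM f) => /mulgI.
  have [r Pr [r' Pr' rr']] : exists2 r, P l r & exists2 r', P l' r' & r * tau = r' * t.
    have [] := T_sep (or_intror ll') (PT (PV Pp) Ttau) (PT (PV Pp') vx) eq'.
      move=> Pn; exists (p'^-1 * t * (p^-1 * tau)^-1 * p^-1); first exact: PM (PV Pp).
      by exists p'^-1; [exact: PV|rewrite !gnorm].
    move=> Pn; exists p^-1; first exact: PV.
    exists ((p'^-1 * t * (p^-1 * tau)^-1)^-1 * p'^-1); first exact: PM (PV Pn) (PV Pp').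
    by rewrite !gnorm.
  rewrite -/(value (Turn l tau e)) -/(value (Turn l' t e')).
  rewrite -(value_Turn_P _ _ Pr) -(value_Turn_P _ _ Pr') rr' /=.
  by rewrite -!conjMg (commute_signed _ _ (adj_commute ll')).
have [Ts coms] := IH _ _ Tx vs adjs.
rewrite comx -[LHS]mulgA coms !mulgA; split=> //.
Qed.

(** After the first turn has moved past s, the conjugating elements of the two
turns agree in Q up to P l; separation makes them agree in the free group, up to
an element of P l, which commutes with l. *)
Lemma cancel_turns l t f s t' e :
  T l t -> valid_word s -> T l t' ->
  all (fun c => wall_adj (inr (l, coset l (f * t^-1))) c.1) (labels f s) ->
  coset l (f * t^-1) = coset l (f * displacements s * t'^-1) ->
  word_value (Turn l t e :: s ++ [:: Turn l t' (~~ e)]) = word_value s.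
Proof.
move=> Tt vs Tt' adjs; rewrite word_value_cons word_value_cat mulgA.
have [Ts ->] := turn_past e Tt vs adjs.
set t1 := t * _ => in_cos.
have : pi (f * t^-1) \in coset l (f * t^-1).
  by apply/cosetP; exists 1; rewrite ?mulg1 //; exact: P1.
rewrite in_cos => /cosetP[p Pp].
have -> : f * t^-1 = f * displacements s * t1^-1 by rewrite invgM mulgA mulgK.
rewrite -!(mulgA (f * _)) !(gmulfM (f * _)) => /mulgI eq.
have eq1 : pi t1 = pi (p^-1 * t').
  by apply: invg_inj; rewrite -!gmulfV [in RHS]invgM invgK.
have Pn : P l (p^-1 * t' * t1^-1).
  by have [] := T_sep (or_introl (erefl l)) Ts (PT (PV Pp) Tt') eq1.
have -> : t' = p * (p^-1 * t' * t1^-1) * t1 by rewrite !gnorm.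
rewrite -mulgA /word_value big_seq1 (value_Turn_P _ _ (PM Pp Pn)).
by rewrite /= signedN conjVg mulgV mulg1.
Qed.

(** A word between two opposite moves along the same edge consists of turns whose
supports contain that edge; each of them can be read at the other end of the
edge, so the moves cancel. *)
Lemma cancel_moves s f b e :
  valid_word s ->
  all (fun c => wall_adj (label f (Move b e)).1 c.1) (labels (f * step b e) s) ->
  displacements s = 1 /\
  exists s', [/\ valid_word s', size s' = size s
    & phi (step b e) * word_value s = word_value s' * phi (step b e)].
Proof.
rewrite label_Move_back; set w := (label _ _).1.
have w_turn l t : T l t -> wall_adj w (inr (l, coset l (f * step b e * t^-1))) ->
    T l (t * step b (~~ e)) by exact: edge_step.
have w_move b' e' g : wall_adj w (label g (Move b' e')).1 = false by [].
move: w w_turn w_move => w w_turn w_move; elim: s => [|x s IH] /=.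
  rewrite /displacements /word_value !big_nil; split=> //; exists [::].
  by rewrite big_nil mulg1 mul1g.
case: x => [b' e'|l t e']; first by rewrite w_move => -[].
rewrite /= mulg1 => -[vt vs] /andP[/(w_turn _ _ vt) Tt /(IH vs) [ds [s' [vs' ss' eqs]]]].
split; first by rewrite displacements_cons mul1g.
exists (Turn l (t * step b (~~ e)) e' :: s'); rewrite /= ss'; split=> //.
rewrite !word_value_cons -[RHS]mulgA -eqs [LHS]mulgA [RHS]mulgA; congr (_ * _).
by rewrite value_Turn_step stepN mulgVK.
Qed.

Lemma shorten_word s : valid_word s -> has_cancelling_pair wall_adj (labels 1 s) ->
  exists s', [/\ valid_word s', (size s' < size s)%N & word_value s' = word_value s].
Proof.
move=> vs [l1 [c [l2 [l3 [eq_l adj_l]]]]].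
have [s1 [s' [es _]]] := labels_cat eq_l; set f := 1 * _.
case: s' es => [|x s'] es //= [lx].
move/labels_cat => [s2 [s'' [es' l2E]]].
case: s'' es' => [|y s3] es' //= [ly _].
rewrite es' {s' es'} in es; rewrite -lx -{}l2E in adj_l ly.
have [vs1 [vx /valid_cat [vs2 [vy vs3]]]] : valid_word s1 /\ valid_word (x :: s2 ++ y :: s3).
  by apply/valid_cat; rewrite -es.
suff [m [vm sm eqm]] : exists m, [/\ valid_word m, (size m < size (x :: s2 ++ [:: y]))%N
    & word_value m = word_value (x :: s2 ++ [:: y])].
  exists (s1 ++ m ++ s3); split.
  - by rewrite !valid_cat.
  - by rewrite es; move: sm; rewrite !size_cat /= !size_cat /=; lia.
  - rewrite es !word_value_cat eqm !word_value_cons !word_value_cat !mulgA.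
    by rewrite [in RHS]word_value_cons /word_value big_seq1 !mulgA.
case: x vx lx adj_l ly {es} => [b e|l t e] vx lx adj_l.
  have [-> [s' [vs' ss' eqs]]] := cancel_moves vs2 adj_l.
  case: y vy => [b' e'|l t e'] vy; last by [].
  rewrite mulg1 => -[_ eb ee].
  exists s'; split=> //; first by rewrite /= size_cat ss'; lia.
  rewrite word_value_cons word_value_cat mulgA eqs /word_value big_seq1 /= ee eb.
  by rewrite stepN gmulfV mulgK.
case: y vy => [b' e'|l' t' e'] vy //= [el et ee].
subst l' e'; move: adj_l et; rewrite /= !mulg1 => adj_l et.
exists s2; split=> //; first by rewrite size_cat /=; lia.
by rewrite (cancel_turns e vx vs2 vy adj_l (esym et)).
Qed.

Lemma exists_word g : exists2 s, valid_word s & word_value s = g.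
Proof.
move: g; apply: G_generated => [|b|l].
- split=> [|_ _ [s vs <-] [s' vs' <-]|_ [s vs <-]].
  + by exists [::]; rewrite /word_value ?big_nil.
  + by exists (s ++ s'); [apply/valid_cat|rewrite word_value_cat].
  elim: s vs => [|x s IH] /=; first by exists [::]; rewrite /word_value ?big_nil ?invg1.
  move=> [vx /IH [s' vs' es']].
  pose y := match x with Move b e => Move b (~~ e) | Turn l t e => Turn l t (~~ e) end.
  exists (s' ++ [:: y]); first by apply/valid_cat; split=> //=; case: x @y vx.
  rewrite word_value_cat es' [in RHS]word_value_cons invgM /word_value big_seq1; congr (_ * _).
  by rewrite /y; case: x {y vx} => [b e|l t e] /=; rewrite ?stepN ?gmulfV // signedN conjVg.
- by exists [:: Move b false]; rewrite //= /word_value big_seq1.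
- exists [:: Turn l 1 false]; first by split; [exact: T1|].
  by rewrite /word_value big_seq1 /= gmulf1 conjg1.
Qed.

(** The images of the generators; words are read from left to right, so that the
relabelling by b comes after the edge from 1 to b. *)
Definition move_image b : automorphism {ffun wall * bool -> int} :=
  artin_letter wall_adj (inl (1, b), false) * relabel wall_act1 wall_actM (pi (free_gen b)).
Definition turn_image l x e : automorphism {ffun wall * bool -> int} :=
  artin_letter wall_adj (inr (l, coset l x), e).

Lemma relabel_turn_image x y l e :
  relabel wall_act1 wall_actM (pi x) * turn_image l y e =
  turn_image l (x * y) e * relabel wall_act1 wall_actM (pi x).
Proof. by rewrite (relabel_artin_letter _ _ wall_act_adj) /= coset_act. Qed.

(** As T l is connected, t is reached from 1 by a path in T l, whose edges have
walls adjacent to the wall of l; only the relabelling by t remains. *)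
Lemma turn_imageJ l t : T l t ->
  turn_image l 1 false ^ free_lift move_image t = turn_image l t^-1 false.
Proof.
apply: (@T_conn l [set t | turn_image l 1 false ^ free_lift move_image t =
                            turn_image l t^-1 false]) => /= [|x b Tx Txb].
  by rewrite free_lift1 conjg1 invg1.
rewrite free_liftM conjgM free_lift_gen.
have -> : turn_image l (x * free_gen b)^-1 false = turn_image l x^-1 false ^ move_image b.
  rewrite /move_image conjgM.
  have -> : turn_image l x^-1 false ^ artin_letter wall_adj (inl (1, b), false) =
            turn_image l x^-1 false.
    rewrite conjgE (artin_letter_commute wall_adj_irr wall_adj_sym) ?mulKg //=.
    apply/asboolP; exists x => //; apply/cosetP; exists 1; first exact: P1.
    by rewrite mulg1 mul1g gmulfV.
  rewrite conjgE; apply: (mulgI (relabel wall_act1 wall_actM (pi (free_gen b)))).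
  by rewrite mulVKg relabel_turn_image invgM mulgA mulgV mul1g.
by split=> [->//|/conjg_inj].
Qed.

Section Image.
Variable rho : {hom G -> automorphism {ffun wall * bool -> int}}.
Hypothesis rho_phi : forall x, rho (phi x) = free_lift move_image x.
Hypothesis rho_turn : forall l, rho (a l) = turn_image l 1 false.
Local Notation R x := (relabel wall_act1 wall_actM (pi x)).

Lemma letter_image f x : valid x ->
  R f * rho (value x) = artin_letter wall_adj (label f x) * R (f * displacement x).
Proof.
case: x => [b e|l t e] /= vx; last first.
  have -> : rho (signed (a l) e ^ phi t) = turn_image l t^-1 e.
    have pos : rho (a l ^ phi t) = turn_image l t^-1 false.
      by rewrite -(turn_imageJ vx) [RHS]conjgE conjgE !gmulfM gmulfV rho_turn !rho_phi.
    rewrite signedJ; case: e => /=; last exact: pos.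
    by rewrite gmulfV pos artin_letterV.
  by rewrite relabel_turn_image mulg1.
rewrite rho_phi /step /eval_letter; case: e => /=; last first.
  rewrite free_lift_gen /move_image mulgA (relabel_artin_letter _ _ wall_act_adj) /= mulg1.
  by rewrite -mulgA -relabelM -gmulfM.
have -> : free_lift move_image (free_gen b)^-1 =
  R (free_gen b)^-1 * artin_letter wall_adj (inl (1, b), true).
  have -> : free_lift move_image (free_gen b)^-1 = (free_lift move_image (free_gen b))^-1.
    exact: (gmulfV (free_lift move_image)).
  rewrite free_lift_gen invgM artin_letterV; congr (_ * _).
  by apply: mulg1_eq; rewrite -relabelM -gmulfM mulgV gmulf1 relabel1.
rewrite mulgA -relabelM -gmulfM (relabel_artin_letter _ _ wall_act_adj) /= mulg1.
by [].
Qed.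

Lemma word_image f s : valid_word s ->
  R f * rho (word_value s) = artin_word wall_adj (labels f s) * R (f * displacements s).
Proof.
elim: s f => [|x s IH] f /=.
  by rewrite /word_value /artin_word /displacements !big_nil gmulf1 !mulg1 mul1g.
move=> [/letter_image vx /IH vs]; rewrite word_value_cons gmulfM mulgA vx.
by rewrite -mulgA vs mulgA /artin_word big_cons displacements_cons mulgA.
Qed.

Lemma shortest_word g : exists s, [/\ valid_word s, word_value s = g
  & ~ has_cancelling_pair wall_adj (labels 1 s)].
Proof.
have [s vs es] := exists_word g.
elim: {s}(size s).+1 {-2}s (ltnSn (size s)) vs es => // n IH s sn vs es.
case: (EM (has_cancelling_pair wall_adj (labels 1 s))) => [/(shorten_word vs)|]; last by exists s.
by move=> [s' [vs' ss' es']]; apply: (IH s') => //; [lia|rewrite es'].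
Qed.

(** A word that cannot be shortened is sent to a reduced word, and the labelling
keeps the length. *)
Lemma image_faithful g : rho g = 1 -> g = 1.
Proof.
have [s [vs <- red]] := shortest_word g => rho1.
have := word_image 1 vs; rewrite rho1 mulg1 mul1g gmulf1 relabel1 => /esym.
move/(reduced_word_faithful wall_adj_irr wall_adj_sym red).
by case: s {vs red rho1} => // _; rewrite /word_value big_nil.
Qed.

End Image.

(** The relations of G hold between the images because an element p of P l lies
in T l, so that conjugation by its image sends the wall of l to itself. *)
Theorem Z_linear_of_separation : Z_linear G.
Proof.
have [||rho [rho_phi rho_turn]] :=
  @G_universal (automorphism {ffun wall * bool -> int}) move_image
    (fun l => turn_image l 1 false).
- move=> l p Pp; have Tp : T l p by rewrite -[p]mulg1; exact: PT Pp (T1 l).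
  have := turn_imageJ Tp; rewrite /turn_image -[p^-1]mul1g coset_mulr; last exact: PV.
  by move=> fix_p; rewrite /commute [RHS]conjgC fix_p.
- move=> l l' ll'; apply: artin_letter_commute wall_adj_irr wall_adj_sym _ _ _ => /=.
  rewrite ll'; apply/existsP; exists (pi 1).
  by apply/andP; split; apply/cosetP; exists 1; rewrite ?mulg1 //; exact: P1.
exact: Z_linear_of_action (image_faithful rho_phi rho_turn).
Qed.

End Amalgam.

(** * Cyclic subgroups of free groups are separable *)

Section Words.
Variable X : choiceType.
Local Notation Fr := (free_group X).
Implicit Types (u v : word X) (a b : X * bool).

Lemma free_class_cat u v : free_class (u ++ v) = free_class u * free_class v.
Proof. by rewrite -free_mulE. Qed.

Lemma free_class1 a : free_class [:: a] = eval_letter (@free_gen X) a.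
Proof.
case: a => x []; rewrite /eval_letter //=.
by have := free_invE [:: (x, false)]; rewrite /inv_word /rev /= => <-.
Qed.

Lemma free_liftV (G : groupType) (f : X -> G) (x : Fr) :
  free_lift f x^-1 = (free_lift f x)^-1.
Proof. exact: gmulfV. Qed.

End Words.

Section Powers.
Variable G : groupType.

Definition powers (c : G) : set G := [set x | exists t s, x = c ^+ t * c ^- s].

Lemma powers_subgroup c : is_subgroup (powers c).
Proof.
have comm m n : commute (c ^+ m) (c ^- n) by apply/commuteV/commuteX2.
split=> [|_ _ [t [s ->]] [t' [s' ->]]|_ [t [s ->]]].
- by exists 0%N, 0%N; rewrite invg1 mulg1.
- exists (t + t')%N, (s' + s)%N; rewrite !expgnDr invgM -!mulgA; congr (_ * _).
  by rewrite !mulgA; congr (_ * _); rewrite comm.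
- by exists s, t; rewrite invgM invgK.
Qed.

Lemma powers_gen c : powers c c.
Proof. by exists 1%N, 0%N; rewrite invg1 mulg1. Qed.

End Powers.

Section Axis.
Variable X : choiceType.
Variable u : word X.
Local Notation Fr := (free_group X).
Local Notation c := (free_class u).

(** The vertices of the bi-infinite path through 1 that reads u over and over:
the axis of u if u is cyclically reduced.  For other words the path backtracks,
but it is still connected and stable under the powers of u. *)
Definition axis : set Fr := [set x | exists p j,
  [/\ powers c p, (j <= size u)%N & x = p * free_class (take j u)]].

Lemma axis1 : axis 1.
Proof.
exists 1, 0%N; split=> //; first by case: (powers_subgroup c).
by rewrite take0 mul1g.
Qed.

Lemma axisM p x : powers c p -> axis x -> axis (p * x).
Proof.
move=> Pp [p' [j [Pp' ju ->]]]; exists (p * p'), j; rewrite mulgA; split=> //.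
by case: (powers_subgroup c) => _ PM _; exact: PM.
Qed.

(** Each vertex of the path is joined to 1 by a part of the path. *)
Lemma axis_connected (Z : set Fr) : Z 1 ->
  (forall x b, axis x -> axis (x * free_gen b) -> (Z x <-> Z (x * free_gen b))) ->
  axis `<=` Z.
Proof.
move=> Z1 Zstep.
have Zletter x a : axis x -> axis (x * free_class [:: a]) ->
    (Z x <-> Z (x * free_class [:: a])).
  rewrite free_class1; case: a => b [] Ax Axb; last exact: Zstep.
  by have := Zstep _ b Axb; rewrite mulgVK => /(_ Ax) [? ?]; split.
have Zprefix p j : powers c p -> (j <= size u)%N ->
    (Z p <-> Z (p * free_class (take j u))).
  move=> Pp; elim: j => [|j IH] ju; first by rewrite take0 mulg1.
  rewrite IH ?(ltnW ju) //; have [a ta] : exists a, take j.+1 u = take j u ++ [:: a].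
    case: u ju => [//|a0 u0] ju.
    by exists (nth a0 (a0 :: u0) j); rewrite cats1 -take_nth.
  have Aj i : (i <= size u)%N -> axis (p * free_class (take i u)) by move=> iu; exists p, i.
  have := Aj _ ju; rewrite ta free_class_cat mulgA => Aj1.
  exact: Zletter (Aj _ (ltnW ju)) Aj1.
have PM := let: And3 _ PM _ := powers_subgroup c in PM.
have PV := let: And3 _ _ PV := powers_subgroup c in PV.
have Zc p : powers c p -> (Z p <-> Z (p * c)).
  by move=> Pp; rewrite -[X in p * free_class X](take_size u); apply: Zprefix.
have Zpow t : Z (c ^+ t).
  by elim: t => [//|t IH]; rewrite expgSr -Zc //; exists t, 0%N; rewrite invg1 mulg1.
have Zpows t s : Z (c ^+ t * c ^- s).
  elim: s => [|s IH]; first by rewrite invg1 mulg1.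
  apply/Zc; first by exists t, s.+1.
  by rewrite expgS invgM !mulgA mulgVK.
move=> _ [_ [j [[t [s ->]] ju ->]]].
have Pp : powers c (c ^+ t * c ^- s) by exists t, s.
exact/(Zprefix _ _ Pp ju)/Zpows.
Qed.

End Axis.

(** The points where the partial map is undefined are as many as those it misses,
so they can be matched. *)
Lemma extend_partial_injection (Y : finType) (r : Y -> Y -> Prop) :
  (forall y z z', r y z -> r y z' -> z = z') ->
  (forall y y' z, r y z -> r y' z -> y = y') ->
  exists p : {perm Y}, forall y z, r y z -> p y = z.
Proof.
move=> r_fun r_inj.
pose D := [set y | `[< exists z, r y z >]]%SET.
have /boolp.choice[f fP] : forall y, exists z, y \in D -> r y z.
  move=> y; case: (boolP (y \in D)) => [|_]; last by exists y.
  by rewrite inE => /asboolP[z ryz]; exists z.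
have f_inj : {in D &, injective f}.
  by move=> y y' /fP ry /fP ry' eq; apply: r_inj ry _; rewrite eq.
pose E := enum (~: D)%SET; pose E' := enum (~: (f @: D))%SET.
have sE : size E = size E'.
  by rewrite -!cardE; apply/eqP; rewrite -(eqn_add2l #|D|) cardsC
    -{1}(card_in_imset f_inj) cardsC.
pose g y := if y \in D then f y else nth y E' (index y E).
have gE y : y \notin D -> index y E < size E' /\ g y \in E'.
  move=> yD; have yE : index y E < size E' by rewrite -sE index_mem mem_enum inE.
  by rewrite /g (negbTE yD) mem_nth.
have g_inj : injective g.
  move=> y y' eq_g; case: (boolP (y \in D)) (boolP (y' \in D)) => yD [] y'D.
  - by move: eq_g; rewrite /g yD y'D; exact: f_inj.
  - have [_] := gE _ y'D; rewrite -eq_g /g yD mem_enum inE => /negP[].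
    exact: imset_f.
  - have [_] := gE _ yD; rewrite eq_g /g y'D mem_enum inE => /negP[].
    exact: imset_f.
  have [iy _] := gE _ yD; have [iy' _] := gE _ y'D.
  move: eq_g; rewrite /g (negbTE yD) (negbTE y'D) (set_nth_default y' y iy).
  move/eqP; rewrite nth_uniq ?enum_uniq // => /eqP eq_i.
  have inE0 w : w \notin D -> w \in E by move=> wD; rewrite mem_enum finset.in_setC.
  by have := congr1 (nth y E) eq_i; rewrite !nth_index ?inE0.
exists (perm g_inj) => y z ryz; rewrite permE /g.
have yD : y \in D by rewrite inE; apply/asboolP; exists z.
by rewrite yD; apply: r_fun (fP _ yD) ryz.
Qed.

Section Separability.
Variable X : choiceType.
Local Notation Fr := (free_group X).

Section OneElement.
Variables (c h : Fr).
Hypothesis ch : ~ powers c h.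

Definition right_coset (x : Fr) : set Fr := [set y | powers c (y * x^-1)].

Lemma right_cosetP x x' : right_coset x = right_coset x' <-> powers c (x' * x^-1).
Proof.
have [P1 PM PV] := powers_subgroup c.
split=> [eq|Px].
  have : right_coset x' x' by rewrite /right_coset /= mulgV.
  by rewrite -eq.
apply/seteqP; split=> y; rewrite /right_coset /= => Py.
  have -> : y * x'^-1 = (y * x^-1) * (x' * x^-1)^-1 by rewrite !gnorm.
  exact: PM Py (PV _ Px).
have -> : y * x^-1 = (y * x'^-1) * (x' * x^-1) by rewrite !gnorm.
exact: PM.
Qed.

Lemma right_coset_mul x x' z : right_coset (x * z) = right_coset (x' * z) <->
  right_coset x = right_coset x'.
Proof. by rewrite !right_cosetP invgM mulgA mulgK. Qed.

(** The cosets of <c> met along words for c and for h.  The basis acts on them by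
partial injections, which suffice to follow the two words. *)
Definition visited : seq (set Fr) :=
  [seq right_coset (free_class (take j (repr c))) | j <- iota 0 (size (repr c)).+1] ++
  [seq right_coset (free_class (take j (repr h))) | j <- iota 0 (size (repr h)).+1].

Lemma follow_word (f : X -> {perm seq_sub visited}) u :
  (forall b y z x, val y = right_coset x -> val z = right_coset (x * free_gen b) ->
    f b y = z) ->
  (forall j, j <= size u -> right_coset (free_class (take j u)) \in visited) ->
  forall y, val y = right_coset 1 ->
  val (free_lift f (free_class u) y) = right_coset (free_class u).
Proof.
move=> fP uP y y1.
suff prefix j : j <= size u ->
    val (free_lift f (free_class (take j u)) y) = right_coset (free_class (take j u)).
  by have := prefix _ (leqnn _); rewrite take_size.
elim: j => [|j IH] ju.
  by rewrite take0 free_lift1 perm1.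
have [a ta] : exists a, take j.+1 u = take j u ++ [:: a].
  case: u ju {uP IH} => [//|a0 u0] ju.
  by exists (nth a0 (a0 :: u0) j); rewrite cats1 -take_nth.
have z1P := uP _ ju; pose z1 : seq_sub visited := SeqSub z1P.
set z0 := free_lift f (free_class (take j u)) y in IH.
have z0E : val z0 = right_coset (free_class (take j u)) by apply: IH; exact: ltnW.
suff -> : free_lift f (free_class (take j.+1 u)) y = z1 by [].
rewrite ta free_class_cat free_liftM permM -/z0.
have z1E : val z1 = right_coset (free_class (take j u) * free_class [:: a]).
  by rewrite /= ta free_class_cat.
rewrite free_liftE /eval_word big_seq1; case: a ta z1E => b [] _ z1E; rewrite /eval_letter /=.
  apply: (canLR (permK _)); apply/esym; apply: fP z1E _.
  by rewrite z0E free_class1 mulgVK.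
by apply: fP z0E _; rewrite z1E free_class1.
Qed.

(** Extend the partial injections to permutations: the image of c fixes the coset
of 1, and the image of h sends it to the coset of h, which is different. *)
Lemma cyclic_separable : exists (Y : finType) (f : X -> {perm Y}),
  free_lift f h \notin <[free_lift f c]>.
Proof.
have /boolp.choice[f fP] : forall b, exists p : {perm seq_sub visited}, forall y z,
    (exists x, val y = right_coset x /\ val z = right_coset (x * free_gen b)) -> p y = z.
  move=> b; apply: extend_partial_injection => y z z'.
    move=> [x [yx zx]] [x' [yx' zx']]; apply: val_inj.
    by rewrite zx zx'; apply/right_coset_mul; rewrite -yx.
  move=> [x [yx zx]] [x' [yx' zx']]; apply: val_inj.
  by rewrite yx yx'; apply/(right_coset_mul _ _ (free_gen b)); rewrite -zx.
have {}fP b y z x : val y = right_coset x -> val z = right_coset (x * free_gen b) -> f b y = z.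
  by move=> yx zx; apply: fP; exists x.
exists (seq_sub visited), f.
have visit_c j : j <= size (repr c) -> right_coset (free_class (take j (repr c))) \in visited.
  by move=> jc; rewrite mem_cat; apply/orP; left; apply/mapP; exists j; rewrite // mem_iota.
have visit_h j : j <= size (repr h) -> right_coset (free_class (take j (repr h))) \in visited.
  by move=> jh; rewrite mem_cat; apply/orP; right; apply/mapP; exists j; rewrite // mem_iota.
have y0P := visit_c 0%N isT; rewrite take0 in y0P.
pose y0 : seq_sub visited := SeqSub y0P.
have y01 : val y0 = right_coset 1 by [].
have := follow_word fP visit_c y01; have := follow_word fP visit_h y01.
rewrite !free_class_repr => yh yc.
have fix_c : free_lift f c y0 = y0.
  apply: val_inj; rewrite yc; apply/esym/right_cosetP; rewrite invg1 mulg1.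
  exact: powers_gen.
apply/negP => /cycleP[i eq_h]; apply: ch.
have : right_coset 1 = right_coset h.
  rewrite -yh eq_h -y01; congr val; elim: i {eq_h} => [|i IH]; first by rewrite perm1.
  by rewrite expgS permM fix_c.
by move/right_cosetP; rewrite invg1 mulg1.
Qed.

End OneElement.

Lemma free_lift_pair (Q1 Q2 : finGroupType) (f1 : X -> Q1) (f2 : X -> Q2) x :
  free_lift (fun b => (f1 b, f2 b) : (Q1 * Q2)%type) x = (free_lift f1 x, free_lift f2 x).
Proof.
rewrite /free_lift /eval_word; elim: (repr x) => [|a u IH]; first by rewrite !big_nil.
by rewrite !big_cons IH; case: a => b [].
Qed.

Lemma cyclics_separable (l : seq (Fr * Fr)) :
  (forall p, p \in l -> ~ powers p.1 p.2) ->
  exists (Q : finGroupType) (f : X -> Q),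
  forall p, p \in l -> free_lift f p.2 \notin <[free_lift f p.1]>.
Proof.
elim: l => [|p l IH] lP; first by exists {perm bool}, (fun=> 1).
have [|Q [f fP]] := IH; first by move=> q ql; apply: lP; rewrite inE ql orbT.
have [Y [f' f'P]] := cyclic_separable (lP p (mem_head _ _)).
exists ({perm Y} * Q)%type, (fun b => (f' b, f b)) => q; rewrite inE !free_lift_pair.
have expg_pair (x : {perm Y}) (y : Q) n : (x, y) ^+ n = (x ^+ n, y ^+ n) :> ({perm Y} * Q)%type.
  by elim: n => // n IHn; rewrite !expgS IHn.
case/predU1P => [->|ql]; apply/negP => /cycleP[i]; rewrite expg_pair => -[e1 e2].
  by case/negP: f'P; rewrite e1 mem_cycle.
by case/negP: (fP q ql); rewrite e2 mem_cycle.
Qed.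

End Separability.

(** * Universal properties and generation *)

Lemma exists_hom (G H : groupType) (f : G -> H) : {morph f : x y / x * y} ->
  exists F : {hom G -> H}, forall x, F x = f x.
Proof.
move=> fM; have f1 : f 1 = 1 by apply: (mulgI (f 1)); rewrite -fM !mulg1.
pose F : {hom G -> H} := HB.pack f (isUMagmaMorphism.Build G H f (f1, fM)).
by exists F.
Qed.

Lemma hom_commg (G H : groupType) (f : {hom G -> H}) x y : f [~ x, y] = [~ f x, f y].
Proof. by rewrite /commg /conjg !gmulfM !gmulfV. Qed.

Lemma powers_min (G : groupType) (c : G) (N : set G) :
  is_subgroup N -> N c -> powers c `<=` N.
Proof.
move=> [N1 NM NV] Nc _ [t [s ->]].
have Npow r : N (c ^+ r) by elim: r => [|r IH]; rewrite ?expgS //; exact: NM.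
by apply: NM => //; exact: NV.
Qed.

Lemma commute_subgroup (G H : groupType) (f : {hom G -> H}) (y : H) :
  is_subgroup [set x | commute (f x) y].
Proof.
split=> /= [|x x' fx fx'|x fx].
- by rewrite gmulf1; apply/commute_sym/commute1.
- by rewrite gmulfM; apply/commute_sym/commuteM; apply/commute_sym.
- by rewrite gmulfV; apply/commute_sym/commuteV/commute_sym.
Qed.

Lemma eq_hom_subgroup (G G1 G2 H : groupType) (f1 : {hom G -> G1}) (f2 : {hom G -> G2})
    (h1 : {hom G1 -> H}) (h2 : {hom G2 -> H}) :
  is_subgroup [set x | h1 (f1 x) = h2 (f2 x)].
Proof.
split=> /= [|x x' e e'|x e]; first by rewrite !gmulf1.
- by rewrite !gmulfM e e'.
- by rewrite !gmulfV e.
Qed.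

Section Quotient.
Variables (G H : groupType) (R : set G) (f : {hom G -> H}).
Hypothesis fR : forall r, R r -> f r = 1.

Lemma normal_closure_ker x : normal_closure R x -> f x = 1.
Proof.
move=> Rx; apply: (Rx [set x | f x = 1]); split; last exact: fR.
split=> [|y z /= fy]; last by rewrite /= conjgE !gmulfM gmulfV fy mul1g mulVg.
split=> /= [|y z fy fz|y fy]; first exact: gmulf1.
- by rewrite gmulfM fy fz mulg1.
- by rewrite gmulfV fy invg1.
Qed.

Lemma quotient_lift :
  exists F : {hom quotient_group R -> H}, forall x, F (to_quotient R x) = f x.
Proof.
have fE x : f (repr (to_quotient R x)) = f x.
  have /to_quotientP/normal_closure_ker := to_quotient_repr (to_quotient R x).
  by rewrite gmulfM gmulfV => /mulg1_eq; rewrite invgK.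
have [|F FE] := @exists_hom (quotient_group R) H (fun q => f (repr q)).
  move=> x y; rewrite -[x]to_quotient_repr -[y]to_quotient_repr -to_quotientM !fE.
  by rewrite gmulfM.
by exists F => x; rewrite FE.
Qed.

End Quotient.

Lemma free_product_lift (I : choiceType) (Gi : I -> groupType) (H : groupType)
    (f : forall i, {hom Gi i -> H}) :
  exists F : {hom free_product Gi -> H},
    forall i (x : Gi i), F (free_product_in x) = f i x.
Proof.
pose g (t : {i : I & Gi i}) := f (tag t) (tagged t).
have [|F FE] := @quotient_lift _ _ (free_product_relators (G := Gi)) (free_lift g).
  move=> _ [i [x [y ->]]].
  by rewrite /= free_liftM free_liftV free_liftM !free_lift_gen /g /= gmulfM mulVg.
by exists F => i x; rewrite FE /= free_lift_gen.
Qed.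

Section StarUniversal.
Variables (m : nat) (GG : star_graph_of_groups m).

Definition central_to (x : central_group GG) : star_pi1 GG :=
  to_quotient _ (central_in x).
Definition leaf_to (i : 'I_m) (x : leaf_group GG i) : star_pi1 GG :=
  to_quotient _ (leaf_in x).

Lemma central_toM : {morph central_to : x y / x * y}.
Proof. by move=> x y; rewrite /central_to /central_in gmulfM to_quotientM. Qed.

Lemma central_to1 : central_to 1 = 1.
Proof. by rewrite /central_to /central_in !gmulf1. Qed.

HB.instance Definition _ := isUMagmaMorphism.Build (central_group GG) (star_pi1 GG)
  central_to (central_to1, central_toM).

Lemma leaf_toM i : {morph @leaf_to i : x y / x * y}.
Proof. by move=> x y; rewrite /leaf_to /leaf_in gmulfM to_quotientM. Qed.

Lemma leaf_to1 i : @leaf_to i 1 = 1.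
Proof. by rewrite /leaf_to /leaf_in !gmulf1. Qed.

HB.instance Definition _ i := isUMagmaMorphism.Build (leaf_group GG i) (star_pi1 GG)
  (@leaf_to i) (@leaf_to1 i, @leaf_toM i).

Lemma central_leaf i (g : edge_group GG i) :
  central_to (alpha GG i g) = leaf_to (omega GG i g).
Proof. by apply/to_quotientP; apply: sub_normal_closure; exists i, g. Qed.

Lemma star_lift (H : groupType) (fc : {hom central_group GG -> H})
    (fl : forall i, {hom leaf_group GG i -> H}) :
  (forall i g, fc (alpha GG i g) = fl i (omega GG i g)) ->
  exists F : {hom star_pi1 GG -> H},
    (forall x, F (central_to x) = fc x) /\ (forall i x, F (@leaf_to i x) = fl i x).
Proof.
move=> eq_f.
pose f (v : option 'I_m) : {hom vertex_group GG v -> H} :=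
  match v with None => fc | Some i => fl i end.
have [F1 F1E] := free_product_lift f.
have [|F FE] := @quotient_lift _ _ (@edge_relators m GG) F1.
  move=> _ [i [g ->]]; rewrite gmulfM gmulfV /central_in /leaf_in.
  by rewrite (F1E None) (F1E (Some i)) /= eq_f mulVg.
exists F; split=> [x|i x]; rewrite FE; first exact: (F1E None).
exact: (F1E (Some i)).
Qed.

Lemma free_group_ind (X : choiceType) (N : set (free_group X)) :
  is_subgroup N -> (forall x, N (free_gen x)) -> forall w, N w.
Proof.
move=> [N1 NM NV] Ngen w; rewrite -[w]free_class_repr.
elim: (repr w) => [//|a u IH]; rewrite -cat1s free_class_cat.
by apply: (NM _ _ _ IH); rewrite free_class1; case: a => x []; [apply: NV|]; exact: Ngen.
Qed.

Lemma star_generated (N : set (star_pi1 GG)) : is_subgroup N ->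
  (forall x, N (central_to x)) -> (forall i x, N (@leaf_to i x)) -> forall g, N g.
Proof.
move=> [N1 NM NV] Nc Nl g; rewrite -[g]to_quotient_repr.
set g1 := repr g; rewrite -[g1]to_quotient_repr.
set g2 := repr g1.
pose N2 := [set x | N (to_quotient _
  (to_quotient (free_product_relators (G := vertex_group GG)) x) : star_pi1 GG)].
apply: (@free_group_ind _ N2) => [|[[i|] x]]; last exact: Nc; last exact: Nl.
split; rewrite /N2 /=.
- by rewrite !gmulf1.
- by move=> x y; rewrite !to_quotientM; exact: NM.
- by move=> x Nx; rewrite !gmulfV; exact: NV.
Qed.

End StarUniversal.

Section Raag.
Variables (K : groupType) (S : set K).
Hypothesis S_raag : raag_generating_set S.

Lemma raag_generated (N : set K) : is_subgroup N -> S `<=` N -> forall x, N x.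
Proof.
move=> [N1 NM NV] SN x; have [R [_ [p_onto _]]] := S_raag.
have : setT x by []; rewrite -p_onto => -[w _ <-].
pose N' := [set w | N (free_lift (fun s : S => val s) w)].
apply: (@free_group_ind _ N') => [|s]; last first.
  by rewrite /N' /= free_lift_gen; apply: SN; apply: set_valP.
split; rewrite /N' /=.
- by rewrite free_lift1.
- by move=> y z; rewrite free_liftM; exact: NM.
- by move=> y Ny; rewrite free_liftV; exact: NV.
Qed.

(** The relators are commutators of generators that commute in K. *)
Lemma raag_lift (H : groupType) (f : S -> H) :
  (forall s t : S, commute (val s) (val t) -> commute (f s) (f t)) ->
  exists F : {hom K -> H}, forall s : S, F (val s) = f s.
Proof.
move=> f_comm; have [R [R_comm [p_onto p_ker]]] := S_raag.
pose p : {hom free_group S -> K} := free_lift (fun s : S => val s).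
have ker_f w : p w = 1 -> free_lift f w = 1.
  move=> pw; have : normal_closure R w by rewrite -p_ker.
  apply: normal_closure_ker => r Rr; have [s [t rE]] := R_comm r Rr.
  have : p r = 1.
    have : [set w | p w = 1] r by rewrite p_ker; exact: sub_normal_closure.
    by [].
  rewrite rE !hom_commg /= !free_lift_gen.
  by move=> /eqP/commgP/f_comm/commgP/eqP.
have /boolp.choice[q qP] x : exists w, p w = x.
  by have : setT x by []; rewrite -p_onto => -[w _ <-]; exists w.
have f_eq w w' : p w = p w' -> free_lift f w = free_lift f w'.
  move=> pw; have /ker_f : p (w^-1 * w') = 1 by rewrite gmulfM gmulfV pw mulVg.
  by rewrite gmulfM gmulfV => /mulg1_eq; rewrite invgK.
have [|F FE] := @exists_hom K H (fun x => free_lift f (q x)).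
  by move=> x y; rewrite -free_liftM; apply: f_eq; rewrite gmulfM !qP.
exists F => s; rewrite FE -[RHS](free_lift_gen f); apply: f_eq.
by rewrite qP /p /= free_lift_gen.
Qed.

(** For each x in S there is a homomorphism to a group of order 2 that is
nontrivial on x and trivial on the rest of S.  These homomorphisms are distinct,
but a finitely generated group has only finitely many homomorphisms to a given
finite group. *)
Lemma raag_finite : finitely_generated K -> finite_set S.
Proof.
move=> [T0 /finite_seqP[t0 ->] t0_gen].
pose c : {perm bool} := tperm true false.
have c1 : c <> 1 by move/(congr1 (fun s : {perm bool} => s true)); rewrite tpermL perm1.
have /boolp.choice[F FP] x : exists F : {hom K -> {perm bool}},
    forall s : S, F (val s) = if val s == x then c else 1.
  apply: raag_lift => s t _.
  by do 2!case: ifP => _; rewrite /commute ?mulg1 ?mul1g.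
pose g x : (size t0).-tuple {perm bool} := [tuple of map (F x) (in_tuple t0)].
have g_inj : {in S &, injective g}.
  move=> x y; rewrite !inE => Sx Sy /(congr1 val) /= /eq_in_map eq_F.
  have FFx : F x x = F y x.
    have : subgroup_generated [set` t0] x by rewrite t0_gen.
    move/(_ [set z | F x z = F y z]); apply; split; last by move=> z; exact: eq_F.
    exact: (eq_hom_subgroup idfun idfun (F x) (F y)).
  have xs := mem_set Sx.
  have := FP x (SigSub xs); have := FP y (SigSub xs); rewrite /= eqxx FFx => ->.
  by case: eqP => // _ /esym.
have := inj_card_eq g_inj; rewrite card_eq_sym => /eq_finite_set ->.
exact: finite_finset.
Qed.

End Raag.

(** * The fundamental group of the star *)

Section AxisSeparation.
Variables (X : choiceType) (u : word X).

Definition prefix_quotients : seq (free_group X) :=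
  [seq free_class (take i u) * (free_class (take j u))^-1
    | i <- iota 0 (size u).+1, j <- iota 0 (size u).+1].

(** Up to powers of u, the quotient of two vertices of the path is a quotient of
two prefixes of u; so only finitely many elements have to be separated. *)
Lemma axis_separated (Q : finGroupType) (pi : {hom free_group X -> Q}) :
  (forall h, h \in prefix_quotients -> ~ powers (free_class u) h ->
     pi h \notin <[pi (free_class u)]>) ->
  forall z z', axis u z -> axis u z' -> pi z = pi z' -> powers (free_class u) (z' * z^-1).
Proof.
have [P1 PM PV] := powers_subgroup (free_class u).
move=> sep _ _ [p [j [Pp ju ->]]] [p' [i [Pp' iu ->]]] eq_pi.
have pi_P q : powers (free_class u) q -> pi q \in <[pi (free_class u)]>.
  move=> [t [s ->]].
  have piX r : pi (free_class u ^+ r) = pi (free_class u) ^+ r.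
    by elim: r => [|r IH]; rewrite ?gmulf1 // !expgS gmulfM IH.
  by rewrite gmulfM gmulfV !piX groupM ?groupV ?mem_cycle.
set h := free_class (take i u) * (free_class (take j u))^-1.
have Ph : powers (free_class u) h.
  have h_in : h \in prefix_quotients.
    by apply/allpairsP; exists (i, j); rewrite !mem_iota.
  apply: contrapT => /(sep _ h_in)/negP; apply.
  have -> : pi h = pi (p'^-1 * p); last exact: pi_P _ (PM _ _ (PV _ Pp') Pp).
  have -> : p'^-1 * p = p'^-1 * (p * free_class (take j u)) * (free_class (take j u))^-1.
    by rewrite !gnorm.
  by rewrite [RHS]gmulfM [pi (p'^-1 * _)]gmulfM eq_pi -!gmulfM mulKg.
have -> : p' * free_class (take i u) * (p * free_class (take j u))^-1 = p' * h * p^-1.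
  by rewrite /h !gnorm.
exact: (PM _ _ (PM _ _ Pp' Ph) (PV _ Pp)).
Qed.

End AxisSeparation.

Section Star.
Variables (m : nat) (GG : star_graph_of_groups m).
Variable k : forall i : 'I_m, edge_group GG i.
Hypothesis edge_cyclic : forall i, generates [set k i].
Variables (n : nat) (b : 'I_n -> central_group GG).
Hypothesis b_basis : bijective (free_lift b).
Variable S : forall i, set (leaf_group GG i).
Hypothesis S_raag : forall i, raag_generating_set (@S i).
Local Notation s i := (omega GG i (k i)).
Hypothesis s_gen : forall i, @S i (s i).
Variable others : forall i, seq (leaf_group GG i).
Hypothesis othersP : forall i x, (x \in @others i) <-> @S i x /\ x <> s i.
Variable u : 'I_m -> word 'I_n.
Hypothesis uP : forall i, free_lift b (free_class (u i)) = alpha GG i (k i).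
Local Notation Fr := (free_group 'I_n).

Definition leaf_letter := {i : 'I_m & seq_sub (@others i)}.
Definition letter_in (v : leaf_letter) : star_pi1 GG := leaf_to (val (tagged v)).

(** The letters whose centralizer contains an edge group. *)
Definition linked (v : leaf_letter) : Prop := commute (val (tagged v)) (s (tag v)).
Definition stabilizer (v : leaf_letter) : set Fr :=
  if `[< linked v >] then powers (free_class (u (tag v))) else [set 1].
Definition support (v : leaf_letter) : set Fr :=
  if `[< linked v >] then axis (u (tag v)) else [set 1].
Definition leaf_commute (v w : leaf_letter) : Prop :=
  exists i (x y : seq_sub (@others i)),
    [/\ v = Tagged (fun i => seq_sub (@others i)) x, w = Tagged (fun i => seq_sub (@others i)) y
      & commute (val x) (val y)].
Definition leaf_adj (v w : leaf_letter) : bool := (v != w) && `[< leaf_commute v w >].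

Lemma leaf_adj_irr : irreflexive leaf_adj.
Proof. by move=> v; rewrite /leaf_adj eqxx. Qed.

Lemma leaf_adj_sym : symmetric leaf_adj.
Proof.
move=> v w; rewrite /leaf_adj eq_sym; congr (_ && _); congr (asbool _).
by apply: propext; split=> -[i [x [y [-> -> xy]]]]; exists i, y, x; split=> //;
  exact: commute_sym.
Qed.

Lemma stabilizer_subgroup v : is_subgroup (stabilizer v).
Proof.
rewrite /stabilizer; case: ifP => _; first exact: powers_subgroup.
by split=> //= [x y -> ->|x ->]; rewrite ?mulg1 ?invg1.
Qed.

Lemma support1 v : support v 1.
Proof. by rewrite /support; case: ifP => _ //; exact: axis1. Qed.

Lemma support_stable v p x : stabilizer v p -> support v x -> support v (p * x).
Proof.
rewrite /stabilizer /support; case: ifP => _; first exact: axisM.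
by move=> -> ->; rewrite /= mulg1.
Qed.

Lemma support_connected v (Z : set Fr) : Z 1 ->
  (forall x c, support v x -> support v (x * free_gen c) ->
     (Z x <-> Z (x * free_gen c))) ->
  support v `<=` Z.
Proof.
rewrite /support; case: ifP => _ Z1; first exact: axis_connected.
by move=> _ _ ->.
Qed.

(** Every basis element of the central group and every leaf generator other than
the s_i is a letter, and s_i is the image of the word u i; this gives generation
and the universal property from those of the factors. *)
Lemma Z_linear_star : Z_linear (star_pi1 GG).
Proof.
pose l := [seq ph <- [seq (free_class (u i), h) | i <- enum 'I_m, h <- prefix_quotients (u i)]
  | `[< ~ powers ph.1 ph.2 >]].
have [q|Q [f fP]] := @cyclics_separable _ l.
  by rewrite mem_filter => /andP[/asboolP].
pose pi : {hom Fr -> Q} := free_lift f.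
have pi_sep i z z' : axis (u i) z -> axis (u i) z' -> pi z = pi z' ->
    powers (free_class (u i)) (z' * z^-1).
  apply: axis_separated => h hi Nh; apply: (fP (free_class (u i), h)).
  rewrite mem_filter; apply/andP; split; first exact/asboolP.
  by apply/allpairsPdep; exists i, h; rewrite mem_enum.
have [g0 bK g0K] := b_basis.
pose basis : {hom Fr -> central_group GG} := free_lift b.
have [|phi phiE] := @exists_hom Fr (star_pi1 GG) (fun x => central_to (basis x)).
  by move=> x y; rewrite gmulfM central_toM.
have [|phi' phi'E] := @exists_hom (central_group GG) Fr g0.
  exact: can2_gmulfM bK g0K.
apply: (@Z_linear_of_separation 'I_n Q pi leaf_letter leaf_adj stabilizer support
  leaf_adj_irr leaf_adj_sym stabilizer_subgroup support1 support_stable support_connected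
  _ _ phi letter_in).
- move=> v w z z' vw; rewrite /support /stabilizer.
  have : linked v /\ linked w -> tag v = tag w.
    case: vw => [->//|/andP[_ /asboolP[i [x [y [-> -> _]]]]]//].
  case: asboolP => Lv; case: asboolP => Lw.
  + by move=> /(_ (conj Lv Lw)) <-; move=> Tz Tz' /(pi_sep _ _ _ Tz Tz'); left.
  + move=> _ Tz -> eq; left; exact: pi_sep Tz (axis1 _) eq.
  + move=> _ -> Tz' eq; right; exact: pi_sep (axis1 _) Tz' eq.
  + by move=> _ -> ->; left; rewrite /= mulgV.
- move=> v p; rewrite /stabilizer; case: asboolP => Lv; last first.
    by move=> ->; rewrite gmulf1; exact/commute_sym/commute1.
  move: p; apply: powers_min; first exact: commute_subgroup.
  rewrite /= phiE /basis /= uP central_leaf /letter_in /commute -!leaf_toM.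
  by rewrite Lv.
- move=> v w /andP[_ /asboolP[i [x [y [-> -> xy]]]]].
  by rewrite /commute /letter_in /= -!leaf_toM xy.
- move=> N N_sub Nb Nl.
  have preim (H1 : groupType) (j : {hom H1 -> star_pi1 GG}) : is_subgroup [set x | N (j x)].
    have [N1 NM NV] := N_sub.
    by split=> /= *; rewrite ?gmulf1 ?gmulfM ?gmulfV //; [exact: NM|exact: NV].
  have Nc x : N (central_to x).
    by rewrite -[x]g0K -/(basis _) -phiE; apply: (@free_group_ind _ [set w | N (phi w)]).
  apply: star_generated => // i.
  apply: (@raag_generated _ _ (S_raag i) [set x | N (leaf_to x)]) => [|x Sx /=].
    exact: preim.
  case: (x =P s i) => [->|xs]; first by rewrite -central_leaf.
  have xl : x \in others i by apply/othersP.
  exact: (Nl (Tagged (fun i => seq_sub (others i)) (SeqSub xl))).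
(* The generator s_i is not a letter: it is sent to the image of w_i. *)
move=> H h leaf_image h_stab h_adj.
pose image i (x : @S i) : H :=
  if insub (val x) : option (seq_sub (others i)) is Some y
  then leaf_image (Tagged (fun i => seq_sub (others i)) y) else free_lift h (free_class (u i)).
have not_inner i (x : @S i) : insub (val x) = None :> option (seq_sub (others i)) -> val x = s i.
  case: insubP => // xl _; apply: contrapT => xs; case/negP: xl; apply/othersP; split=> //.
  exact: set_valP.
have link_comm i (y : seq_sub (others i)) : commute (val y) (s i) ->
    commute (leaf_image (Tagged (fun i => seq_sub (others i)) y)) (free_lift h (free_class (u i))).
  move=> ys; apply/commute_sym/h_stab; rewrite /stabilizer asboolT //.
  exact: powers_gen.
have [fl flE] : exists fl : forall i, {hom leaf_group GG i -> H},
    forall i (x : @S i), fl i (val x) = image i x.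
  apply: (@fin_all_exists _ _ (fun i (F : {hom leaf_group GG i -> H}) =>
     forall x : @S i, F (val x) = image i x)) => i.
  apply: raag_lift => // x y xy; rewrite /image.
  case ex : insub => [x'|]; case ey : insub => [y'|].
  - have x'E : val x' = val x by move: ex; case: insubP => // ? _ <- [->].
    have y'E : val y' = val y by move: ey; case: insubP => // ? _ <- [->].
    case: (x' =P y') => [->|/eqP xy']; first exact: commute_refl.
    apply: h_adj; apply/andP; split; first by rewrite eq_Tagged.
    by apply/asboolP; exists i, x', y'; rewrite x'E y'E.
  - have x'E : val x' = val x by move: ex; case: insubP => // ? _ <- [->].
    by apply: link_comm; rewrite x'E -(not_inner _ _ ey).
  - have y'E : val y' = val y by move: ey; case: insubP => // ? _ <- [->].
    by apply/commute_sym/link_comm; rewrite y'E -(not_inner _ _ ex); exact: commute_sym.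
  - exact: commute_refl.
pose hh : {hom Fr -> H} := free_lift h.
have [|fc fcE] := @exists_hom (central_group GG) H (fun x => hh (phi' x)).
  by move=> x y; rewrite !gmulfM.
have [|rho [rho_c rho_l]] := @star_lift _ GG H fc fl.
  move=> i; have : subgroup_generated [set k i] `<=`
      [set g | fc (alpha GG i g) = fl i (omega GG i g)].
    move=> g; apply; split; first exact: eq_hom_subgroup.
    move=> _ ->; rewrite /= fcE phi'E -uP bK.
    have sS := mem_set (s_gen i); have := flE i (SigSub sS); rewrite /= => ->.
    rewrite /image insubN //=; apply/negP => /othersP[_]; exact.
  by rewrite edge_cyclic => sub g; apply: sub.
exists rho; split=> [x|[i x]]; first by rewrite phiE rho_c fcE phi'E /basis /= bK.
rewrite /letter_in rho_l /=.
have /othersP[Sx _] : val x \in others i by exact: valP.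
by have := flE i (SigSub (mem_set Sx)); rewrite /image /= valK => ->.
Qed.
End Star.

Theorem corollary4p3 (m : nat) (GG : star_graph_of_groups m)
    (V : forall i : 'I_m, set (leaf_group GG i))
    (k : forall i : 'I_m, edge_group GG i)
    (central_free : free_of_finite_rank (central_group GG))
    (leaf_raag : forall i, raag_generating_set (V i))
    (leaf_fg : forall i, finitely_generated (leaf_group GG i))
    (edge_cyclic : forall i, generates [set k i])
    (omega_gen : forall i, V i (omega GG i (k i)) \/
       exists2 S : set (leaf_group GG i),
         raag_generating_set S & S (omega GG i (k i))) :
  Z_linear (star_pi1 GG).
Proof.
have [n [b b_basis]] := central_free.
have [S SP] : exists S : forall i, set (leaf_group GG i), forall i,
    raag_generating_set (S i) /\ S i (omega GG i (k i)).
  apply: (@fin_all_exists _ _ (fun i (S : set (leaf_group GG i)) =>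
    raag_generating_set S /\ S (omega GG i (k i)))) => i.
  by case: (omega_gen i) => [Vs|[S]]; [exists (V i)|exists S].
have [others othersP] : exists others : forall i, seq (leaf_group GG i), forall i x,
    (x \in others i) <-> S i x /\ x <> omega GG i (k i).
  apply: (@fin_all_exists _ _ (fun i (others : seq (leaf_group GG i)) => forall x,
    (x \in others) <-> S i x /\ x <> omega GG i (k i))) => i.
  have /finite_seqP[l Sl] := raag_finite (SP i).1 (leaf_fg i).
  exists [seq x <- l | x != omega GG i (k i)] => x.
  rewrite mem_filter Sl /=; split=> [/andP[/eqP]|[xl /eqP ->]] //.
have [g0 _ g0K] := b_basis.
apply: (@Z_linear_star m GG k edge_cyclic n b b_basis S _ _ others othersP
  (fun i => repr (g0 (alpha GG i (k i))))) => i.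
- exact: (SP i).1.
- exact: (SP i).2.
- by rewrite free_class_repr g0K.
Qed.
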